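(* Let $T>0$, $\mathcal{R}=\frac{2\pi}{T}$, $S^1=\mathbb{R}/2\pi\mathbb{Z}$, $\mathbb{T}^2=(\mathbb{R}/T\mathbb{Z})\times(\mathbb{R}/2\pi\mathbb{Z})$ with coordinates $(t,x)$ and $dV=dt\wedge dx$. Let $V_t:S^1\to\mathbb{R}$ be a family of potentials, smooth and $T$-periodic in $t$ and uniformly bounded by a constant, and let $\rho:\mathbb{R}\to\mathbb{R}$ be smooth with support in $(-r,r)$ for some $r<\pi$ (regarded also as a function on $S^1$). For $f:S^1\to\mathbb{R}$ set $(f*\rho)(q)=\int_{S^1}f(x)\rho(q-x)\,dx$. Write $u=(q,p)\in T^*S^1=S^1\times\mathbb{R}$ and $Z=(\varphi,\pi_1,\pi_2,o)\in\mathbb{R}^4$, and let \[ H_t(u,\varphi(\cdot))=\tfrac12p^2+V_t(q)+(\varphi*\rho)(q),\qquad S_{t,x}(u,Z)=\tfrac12\varphi^2+\tfrac12\pi_1^2-\tfrac12\pi_2^2-\tfrac12o^2+\varphi\,\rho(q-x). \] Let $J=\begin{pmatrix}0&-1\\1&0\end{pmatrix}$ and \[ M_1=\begin{pmatrix}0&-1&0&0\\1&0&0&0\\0&0&0&1\\0&0&-1&0\end{pmatrix},\qquad M_2=\begin{pmatrix}0&0&1&0\\0&0&0&-1\\-1&0&0&0\\0&1&0&0\end{pmatrix}. \] Let $\widetilde{F}=(\widetilde{u},\widetilde{Z})$ with $\widetilde{u}=(\widetilde{q},\widetilde{p}):\mathbb{R}\times(\mathbb{R}/T\mathbb{Z})\to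 T^*S^1$ and $\widetilde{Z}:\mathbb{R}\times\mathbb{T}^2\to\mathbb{R}^4$ smooth, solving \[ \partial_s\widetilde{u}(s,t)=-J\partial_t\widetilde{u}(s,t)+\nabla_uH_t\big(\widetilde{u}(s,t),\widetilde{\varphi}(s,t,\cdot)\big), \] \[ \partial_s\widetilde{Z}(s,t,x)=-M_1\partial_t\widetilde{Z}(s,t,x)-M_2\partial_x\widetilde{Z}(s,t,x)+\nabla_ZS_{t,x}\big(\widetilde{u}(s,t),\widetilde{Z}(s,t,x)\big), \] where $\widetilde{\varphi}$ is the first component of $\widetilde{Z}$ and $\nabla_u,\nabla_Z$ are the gradients in the $u$ and $Z$ variables, and having finite energy \[ E(\widetilde{F})=\int_{-\infty}^{+\infty}\left(\int_{\mathbb{R}/T\mathbb{Z}}|\partial_s\widetilde{u}(s,t)|^2\,dt+\int_{\mathbb{T}^2}|\partial_s\widetilde{Z}(s,t,x)|^2\,dV\right)ds<+\infty. \] Assume there exists a smooth $u^+:\mathbb{R}/T\mathbb{Z}\to T^*S^1$ such that $\widetilde{u}_s:=\widetilde{u}(s,\cdot)\to u^+$ and $\partial_s\widetilde{u}_s\to0$ in the $C^\infty$-topology as $s\to+\infty$. If $\mathcal{R}^{-2}=\left(\frac{T}{2\pi}\right)^2$ has irrationality measure equal to $2$, then there exists $Z^+\in C^\infty(\mathbb{T}^2,\mathbb{R}^4)$ such that $\lim_{s\to+\infty}\widetilde{Z}_s=Z^+$ in the $C^\infty$-topology, where $\widetilde{Z}_s=\widetilde{Z}(s,\cdot,\cd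ot)$.
   Context: The irrationality measure of a real number $r$ is the infimum of all $\rho$ for which there exists a constant $c$ such that $\frac{c}{q^\rho}<|r-\frac{p}{q}|$ for all $\frac{p}{q}\in\mathbb{Q}$. *)

(* Defs.v *)
From Stdlib Require Import Reals List.
From Coquelicot Require Import Coquelicot.
Open Scope R_scope.

(* A point of R^n is a map nat -> R whose coordinates 0..n-1 are used. *)
Definition upd (x : nat -> R) (i : nat) (y : R) : nat -> R :=
  fun j => if Nat.eqb j i then y else x j.

Definition pd (i : nat) (f : (nat -> R) -> R) : (nat -> R) -> R :=
  fun x => Derive (fun y => f (upd x i y)) (x i).

Definition Dlist (l : list nat) (f : (nat -> R) -> R) : (nat -> R) -> R :=
  fold_right pd f l.

Definition contn (n : nat) (g : (nat -> R) -> R) : Prop :=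
  forall x eps, 0 < eps -> exists delta, 0 < delta /\
    forall y, (forall j, (j < n)%nat -> Rabs (y j - x j) < delta) ->
      Rabs (g y - g x) < eps.

(* C^infinity in n variables: all iterated partial derivatives exist
   everywhere and are continuous (there is a family containing f, closed
   under partial differentiation, of continuous partially differentiable maps) *)
Definition smoothn (n : nat) (f : (nat -> R) -> R) : Prop :=
  exists P : ((nat -> R) -> R) -> Prop, P f /\
    forall g, P g -> contn n g /\
      forall i, (i < n)%nat ->
        (forall x, ex_derive (fun y => g (upd x i y)) (x i)) /\ P (pd i g).

Definition pt2 (a b : R) : nat -> R := fun j => match j with O => a | _ => b end.
Definition pt3 (a b c : R) : nat -> R :=
  fun j => match j with O => a | 1%nat => b | _ => c end.

Definition smooth1 (f : R -> R) : Prop := smoothn 1 (fun v => f (v O)).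
Definition smooth2 (f : R -> R -> R) : Prop := smoothn 2 (fun v => f (v O) (v 1%nat)).
Definition smooth3 (f : R -> R -> R -> R) : Prop :=
  smoothn 3 (fun v => f (v O) (v 1%nat) (v 2%nat)).

Fixpoint sumR (n : nat) (f : nat -> R) : R :=
  match n with O => 0 | S m => sumR m f + f m end.

Definition matvec (n : nat) (M : nat -> nat -> R) (v : nat -> R) : nat -> R :=
  fun i => sumR n (fun j => M i j * v j).

Definition Jmat (i j : nat) : R :=
  match i, j with
  | O, 1%nat => -1 | 1%nat, O => 1
  | _, _ => 0 end.

Definition M1 (i j : nat) : R :=
  match i, j with
  | O, 1%nat => -1 | 1%nat, O => 1 | 2%nat, 3%nat => 1 | 3%nat, 2%nat => -1
  | _, _ => 0 end.

Definition M2 (i j : nat) : R :=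
  match i, j with
  | O, 2%nat => 1 | 1%nat, 3%nat => -1 | 2%nat, O => -1 | 3%nat, 1%nat => 1
  | _, _ => 0 end.

Definition vec2 (a b : R) : nat -> R := fun j => match j with O => a | _ => b end.

(* rho regarded as a function on S^1 = R/2piZ: evaluate rho at the
   representative of y in [-pi, pi). *)
Definition rho_per (rho : R -> R) (y : R) : R :=
  rho (y - 2 * PI * IZR (Int_part ((y + PI) / (2 * PI)))).

Definition conv (rho : R -> R) (f : R -> R) (q : R) : R :=
  RInt (fun x => f x * rho_per rho (q - x)) 0 (2 * PI).

Definition Ham (V : R -> R -> R) (rho : R -> R) (t q p : R) (phi : R -> R) : R :=
  / 2 * p ^ 2 + V t q + conv rho phi q.

Definition gradH (V : R -> R -> R) (rho : R -> R) (t q p : R) (phi : R -> R) : nat -> R :=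
  vec2 (Derive (fun q' => Ham V rho t q' p phi) q)
       (Derive (fun p' => Ham V rho t q p' phi) p).

(* S_{t,x}(u, Z) with Z = (Z 0, Z 1, Z 2, Z 3) = (phi, pi1, pi2, o) *)
Definition Sfun (rho : R -> R) (t x q p : R) (Z : nat -> R) : R :=
  / 2 * (Z 0%nat) ^ 2 + / 2 * (Z 1%nat) ^ 2 - / 2 * (Z 2%nat) ^ 2 - / 2 * (Z 3%nat) ^ 2
  + Z 0%nat * rho_per rho (q - x).

Definition gradS (rho : R -> R) (t x q p : R) (Z : nat -> R) : nat -> R :=
  fun i => Derive (fun y => Sfun rho t x q p (upd Z i y)) (Z i).

Definition irr_exponents (r : R) : R -> Prop :=
  fun rho => exists c, 0 < c /\
    forall (p : Z) (q : nat), (0 < q)%nat ->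
      c / Rpower (INR q) rho < Rabs (r - IZR p / INR q).

Definition irrationality_measure_eq (r m : R) : Prop :=
  (forall rho, irr_exponents r rho -> m <= rho) /\
  (forall m', (forall rho, irr_exponents r rho -> m' <= rho) -> m' <= m).

(* Main.v *)
Require Import Defs.
From Stdlib Require Import Reals List Lra Lia Psatz ZArith ClassicalEpsilon
  FunctionalExtensionality Ranalysis5.
From Coquelicot Require Import Coquelicot.
Open Scope R_scope.

(** The fields solve the linear system [Z_s = A Z + f] with [A] symmetric, of first order on the
    torus, and with forcing [f = rho (q - x)] in the first component.  On the Fourier mode
    [(m, k)] the eigenvalues of [A] are [+-omega +- sqrt (1 + k^2)] with [omega = 2 pi m / T];
    since [(T / 2 pi)^2] has irrationality measure 2, they are bounded below by a negative power
    of [weight m k = (1 + m^2) (1 + k^2)].  An eigencomponent solves [a' = lam a + g] with [g]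
    convergent: if [lam < 0] it relaxes to [- lim g / lam], and if [lam > 0] it does so as well,
    because finite energy excludes exponential growth.  The forcing converges faster than any
    power of [weight] (interpolate between uniform convergence and uniform bounds on all
    derivatives), which absorbs the small divisors, so that the Fourier coefficients of [Z_s] are
    Cauchy with rapidly decaying bounds.  Fejer's theorem turns this into uniform Cauchy bounds
    for all derivatives. *)

(** * Continuity and parametric integrals *)

(** No lower bound on the eigenvalues uniform in the mode is available, hence no common exponential
    rate. What survives is uniformity up to powers of [weight]: estimates have the form eps / weight
    ^ N for arbitrary N, with a threshold in s common to all modes, so a fixed loss of powers is
    harmless. Exponentials are accordingly replaced by the crude bounds exp (- x) <= 1 / x and exp x
    >= x ^ 2 / 4, which cost only powers of the eigenvalue. The arithmetic hypothesis enters through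
    a product of conjugate eigenvalues: omega ^ 2 - (1 + k ^ 2) is - (2 pi / T) ^ 2 (1 + k ^ 2)
    times the error of approximating (T / 2 pi) ^ 2 by the rational m ^ 2 / (1 + k ^ 2). Finite
    energy yields linear growth in s of each coefficient. The constant may depend on the mode,
    because it only serves to exclude a growing exponential and does not enter the resulting
    estimate. The limit field is not written down explicitly: everything is a Cauchy estimate, and
    each derivative receives its own uniform limit. *)

Lemma ex_RInt_cont (f : R -> R) a b : (forall x, continuous f x) -> ex_RInt f a b.
Proof. intros H. apply (@ex_RInt_continuous R_CompleteNormedModule). intros; apply H. Qed.

Definition cont2 (g : R -> R -> R) : Prop :=
  forall t x eps, 0 < eps -> exists d, 0 < d /\ forall t' x',
    Rabs (t' - t) < d -> Rabs (x' - x) < d -> Rabs (g t' x' - g t x) < eps.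

Definition cont3 (f : R -> R -> R -> R) : Prop :=
  forall s t x eps, 0 < eps -> exists d, 0 < d /\ forall s' t' x',
    Rabs (s' - s) < d -> Rabs (t' - t) < d -> Rabs (x' - x) < d ->
    Rabs (f s' t' x' - f s t x) < eps.

Lemma continuous_eps {U : UniformSpace} (h : U -> R) (u : U) :
  continuous h u <-> forall eps, 0 < eps -> locally u (fun u' => Rabs (h u' - h u) < eps).
Proof.
  split; intros H.
  - intros eps He. apply (H (fun y => Rabs (y - h u) < eps)).
    exists (mkposreal eps He). intros y Hy. exact Hy.
  - intros P [e HP]. specialize (H e (cond_pos e)).
    unfold filtermap. revert H. apply filter_imp. intros u' Hu. apply HP. exact Hu.
Qed.

Lemma cont2_comp {U : UniformSpace} g (a b : U -> R) u :
  cont2 g -> continuous a u -> continuous b u -> continuous (fun u => g (a u) (b u)) u.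
Proof.
  intros Hg Ha Hb. rewrite continuous_eps in *. intros eps He.
  destruct (Hg (a u) (b u) eps He) as (d & Hd & H).
  generalize (filter_and _ _ (Ha d Hd) (Hb d Hd)). apply filter_imp.
  intros u' [H1 H2]. now apply H.
Qed.

Lemma cont3_comp {U : UniformSpace} f (a b c : U -> R) u :
  cont3 f -> continuous a u -> continuous b u -> continuous c u ->
  continuous (fun u => f (a u) (b u) (c u)) u.
Proof.
  intros Hg Ha Hb Hc. rewrite continuous_eps in *. intros eps He.
  destruct (Hg (a u) (b u) (c u) eps He) as (d & Hd & H).
  generalize (filter_and _ _ (filter_and _ _ (Ha d Hd) (Hb d Hd)) (Hc d Hd)). apply filter_imp.
  intros u' [[H1 H2] H3]. now apply H.
Qed.

Lemma cont2_intro g :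
  (forall p : R * R, continuous (fun p => g (fst p) (snd p)) p) -> cont2 g.
Proof.
  intros H t x eps He. specialize (H (t, x)). rewrite continuous_eps in H.
  destruct (H eps He) as [d Hd]. exists d. split; [apply cond_pos|].
  intros t' x' H1 H2. apply (Hd (t', x')). split; [exact H1 | exact H2].
Qed.

Lemma cont2_plus f g : cont2 f -> cont2 g -> cont2 (fun t x => f t x + g t x).
Proof.
  intros Hf Hg. apply cont2_intro. intros p.
  apply (continuous_plus (fun p => f (fst p) (snd p)) (fun p => g (fst p) (snd p)));
    apply cont2_comp; first [assumption | apply continuous_fst | apply continuous_snd].
Qed.

Lemma cont2_mult f g : cont2 f -> cont2 g -> cont2 (fun t x => f t x * g t x).
Proof.
  intros Hf Hg. apply cont2_intro. intros p.
  apply (continuous_mult (fun p => f (fst p) (snd p)) (fun p => g (fst p) (snd p)));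
    apply cont2_comp; first [assumption | apply continuous_fst | apply continuous_snd].
Qed.

Lemma cont2_const c : cont2 (fun _ _ => c).
Proof. apply cont2_intro. intros p. apply continuous_const. Qed.

Lemma cont2_fst (h : R -> R) : (forall t, continuous h t) -> cont2 (fun t _ => h t).
Proof.
  intros H. apply cont2_intro. intros p.
  apply (continuous_comp fst h); [apply continuous_fst | apply H].
Qed.

Lemma cont2_snd (h : R -> R) : (forall t, continuous h t) -> cont2 (fun _ x => h x).
Proof.
  intros H. apply cont2_intro. intros p.
  apply (continuous_comp snd h); [apply continuous_snd | apply H].
Qed.

Lemma cont2_opp f : cont2 f -> cont2 (fun t x => - f t x).
Proof.
  intros H t x eps He. destruct (H t x eps He) as (d & Hd & H'). exists d; split; [exact Hd|].
  intros t' x' H1 H2. replace (- f t' x' - - f t x) with (- (f t' x' - f t x)) by ring.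
  rewrite Rabs_Ropp. auto.
Qed.

Lemma cont2_minus f g : cont2 f -> cont2 g -> cont2 (fun t x => f t x - g t x).
Proof. intros Hf Hg. apply cont2_plus; [|apply cont2_opp]; assumption. Qed.

Lemma cont2_1 g t : cont2 g -> forall x, continuous (g t) x.
Proof.
  intros Hg x. apply (cont2_comp g (fun _ => t) (fun x => x));
    first [assumption | apply continuous_const | apply continuous_id].
Qed.

Lemma cont2_2 g x : cont2 g -> forall t, continuous (fun t => g t x) t.
Proof.
  intros Hg t. apply (cont2_comp g (fun t => t) (fun _ => x));
    first [assumption | apply continuous_const | apply continuous_id].
Qed.

Lemma cont3_slice f s : cont3 f -> cont2 (f s).
Proof.
  intros H. apply cont2_intro. intros p.
  apply (cont3_comp f (fun _ => s) fst snd);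
    first [assumption | apply continuous_const | apply continuous_fst | apply continuous_snd].
Qed.

Lemma continuous_RInt_param {U : UniformSpace} (F : U -> R -> R) a b :
  a <= b ->
  (forall p : U * R, continuous (fun p => F (fst p) (snd p)) p) ->
  forall u, continuous (fun u => RInt (F u) a b) u.
Proof.
  intros Hab HF u.
  assert (Hc : forall v x, continuous (F v) x).
  { intros v x. apply (continuous_comp_2 (fun _ => v) (fun x => x) F x);
      [apply continuous_const | apply continuous_id | apply (HF (v, x))]. }
  apply continuous_eps. intros eps He.
  set (e := eps / (2 * (b - a + 1))).
  assert (He' : 0 < e) by (apply Rdiv_lt_0_compat; lra).
  assert (Hx : forall x, exists d : posreal, forall u' x', ball u d u' -> Rabs (x' - x) < d ->
     Rabs (F u' x' - F u x) < e / 2).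
  { intros x. specialize (HF (u, x)). rewrite continuous_eps in HF.
    destruct (HF (e / 2)) as [d Hd]; [lra|]. exists d. intros u' x' H1 H2.
    apply (Hd (u', x')). split; assumption. }
  set (delta := fun x => proj1_sig (constructive_indefinite_description _ (Hx x))).
  assert (Hdelta : forall x u' x', ball u (delta x) u' -> Rabs (x' - x) < delta x ->
     Rabs (F u' x' - F u x) < e / 2).
  { intros x. unfold delta. destruct (constructive_indefinite_description _ (Hx x)) as [d Hd].
    exact Hd. }
  destruct (compactness_value_1d a b delta) as [d Hd].
  exists d. intros u' Hu'.
  rewrite <- (RInt_minus (V := R_CompleteNormedModule)); try (apply ex_RInt_cont; apply Hc).
  apply Rle_lt_trans with ((b - a) * e).
  - apply abs_RInt_le_const; [exact Hab | |].
    + apply (ex_RInt_minus (V := R_NormedModule)); apply ex_RInt_cont; apply Hc.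
    (* Compactness gives the nearby centre [y] only under a double negation, so the bound is proved
       by contradiction; both values are then compared with [F u y]. *)
    + intros x Hx'. apply Rnot_lt_le. intros Hlt. apply (Hd x Hx'). intros (y & _ & Hxy & Hdy).
      assert (H1 := Hdelta y u' x (ball_le _ _ _ Hdy _ Hu') Hxy).
      assert (H2 := Hdelta y u x (ball_center _ _) Hxy).
      unfold minus, plus, opp in Hlt; simpl in Hlt.
      replace (F u' x + - F u x) with ((F u' x - F u y) + - (F u x - F u y)) in Hlt by ring.
      pose proof (Rabs_triang (F u' x - F u y) (- (F u x - F u y))) as H3.
      rewrite Rabs_Ropp in H3. lra.
  - unfold e.
    replace ((b - a) * (eps / (2 * (b - a + 1)))) with (((b - a) / (b - a + 1)) * (eps / 2))
      by (field; lra).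
    assert ((b - a) / (b - a + 1) <= 1).
    { apply (Rmult_le_reg_r (b - a + 1)); [lra|]. unfold Rdiv. rewrite Rmult_assoc, Rinv_l; lra. }
    nra.
Qed.

Lemma is_derive_RInt_param_C1 (f f' : R -> R -> R) a b u :
  (forall u v, is_derive (fun z => f z v) u (f' u v)) -> cont2 f' ->
  (forall u v, continuous (f u) v) ->
  is_derive (fun u => RInt (f u) a b) u (RInt (f' u) a b).
Proof.
  intros Hd Hc Hf.
  rewrite (RInt_ext (f' u) (fun t => Derive (fun u => f u t) u))
    by (intros v _; symmetry; apply is_derive_unique; apply Hd).
  apply (is_derive_RInt_param f a b u).
  - exists (mkposreal 1 Rlt_0_1). intros y _ t _. eexists. apply Hd.
  - intros t _. apply continuity_2d_pt_ext with (f := f').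
    { intros x y. symmetry. apply is_derive_unique. apply Hd. }
    intros eps. destruct (Hc u t eps (cond_pos eps)) as (d & Hd' & H).
    exists (mkposreal d Hd'). intros; apply H; assumption.
  - exists (mkposreal 1 Rlt_0_1). intros y _. apply ex_RInt_cont. apply Hf.
Qed.

(** * Integrals over the torus and Fourier coefficients *)

Definition I2 (T : R) (g : R -> R -> R) : R :=
  RInt (fun t => RInt (g t) 0 (2 * PI)) 0 T.

Lemma two_PI_pos : 0 < 2 * PI.
Proof. pose proof PI_RGT_0. lra. Qed.

Lemma cont2_RInt g a b : a <= b -> cont2 g -> forall t, continuous (fun t => RInt (g t) a b) t.
Proof.
  intros Hab Hg. apply continuous_RInt_param; [exact Hab|].
  intros p. apply cont2_comp; [exact Hg | apply continuous_fst | apply continuous_snd].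
Qed.

Lemma cont2_inner g : cont2 g -> forall t, continuous (fun t => RInt (g t) 0 (2 * PI)) t.
Proof. apply cont2_RInt. pose proof two_PI_pos; lra. Qed.

Lemma ex_RInt_inner g t a b : cont2 g -> ex_RInt (g t) a b.
Proof. intros H. apply ex_RInt_cont. now apply cont2_1. Qed.

Lemma ex_RInt_outer g a b : cont2 g -> ex_RInt (fun t => RInt (g t) 0 (2 * PI)) a b.
Proof. intros H. apply ex_RInt_cont. now apply cont2_inner. Qed.

Lemma RInt_extR (f g : R -> R) a b : (forall x, f x = g x) -> RInt f a b = RInt g a b.
Proof. intros H. apply RInt_ext. intros; apply H. Qed.

Lemma RInt_plusR (f g : R -> R) a b : ex_RInt f a b -> ex_RInt g a b ->
  RInt (fun x => f x + g x) a b = RInt f a b + RInt g a b.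
Proof. apply (RInt_plus (V := R_CompleteNormedModule)). Qed.

Lemma RInt_scalR (f : R -> R) a b c : ex_RInt f a b ->
  RInt (fun x => c * f x) a b = c * RInt f a b.
Proof. intros H. now apply (RInt_scal (V := R_CompleteNormedModule)). Qed.

Lemma RInt_constR a b c : RInt (fun _ => c) a b = (b - a) * c.
Proof. apply (RInt_const (V := R_CompleteNormedModule)). Qed.

Lemma I2_ext T f g : (forall t x, f t x = g t x) -> I2 T f = I2 T g.
Proof.
  intros H. apply RInt_extR. intros t. apply RInt_extR. intros x. apply H.
Qed.

Lemma I2_plus T f g : cont2 f -> cont2 g -> I2 T (fun t x => f t x + g t x) = I2 T f + I2 T g.
Proof.
  intros Hf Hg. unfold I2.
  rewrite <- RInt_plusR by now apply ex_RInt_outer.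
  apply RInt_extR. intros t. apply RInt_plusR; now apply ex_RInt_inner.
Qed.

Lemma I2_scal T c f : cont2 f -> I2 T (fun t x => c * f t x) = c * I2 T f.
Proof.
  intros Hf. unfold I2. rewrite <- RInt_scalR by now apply ex_RInt_outer.
  apply RInt_extR. intros t. apply RInt_scalR. now apply ex_RInt_inner.
Qed.

Lemma I2_le T f g : 0 < T -> cont2 f -> cont2 g -> (forall t x, f t x <= g t x) ->
  I2 T f <= I2 T g.
Proof.
  intros HT Hf Hg H. apply RInt_le; try (now apply ex_RInt_outer); [lra|].
  intros t _. apply RInt_le; try (now apply ex_RInt_inner); [pose proof two_PI_pos; lra|].
  intros x _. apply H.
Qed.

Lemma I2_const T c : I2 T (fun _ _ => c) = 2 * PI * T * c.
Proof.
  unfold I2. rewrite (RInt_extR _ (fun _ => 2 * PI * c)).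
  - rewrite RInt_constR. ring.
  - intros t. rewrite RInt_constR. ring.
Qed.

Lemma I2_abs T f g : 0 < T -> cont2 f -> cont2 g -> (forall t x, Rabs (f t x) <= g t x) ->
  Rabs (I2 T f) <= I2 T g.
Proof.
  intros HT Hf Hg H. apply Rabs_le. split.
  - replace (- I2 T g) with (I2 T (fun t x => (-1) * g t x)) by (rewrite I2_scal by easy; ring).
    apply I2_le; auto.
    + apply cont2_mult; [apply cont2_const | easy].
    + intros t x. specialize (H t x). apply Rabs_le_between in H. lra.
  - apply I2_le; auto. intros t x. specialize (H t x). apply Rabs_le_between in H. lra.
Qed.

Lemma RInt_primitive (F f : R -> R) a b :
  (forall x, is_derive F x (f x)) -> (forall x, continuous f x) -> RInt f a b = F b - F a.
Proof.
  intros HF Hf. apply is_RInt_unique. apply (is_RInt_derive (V := R_CompleteNormedModule)); auto.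
Qed.

Lemma I2_dx T (g g' : R -> R -> R) : cont2 g' ->
  (forall t x, is_derive (g t) x (g' t x)) -> (forall t, g t (2 * PI) = g t 0) ->
  I2 T g' = 0.
Proof.
  intros Hc Hd Hp. rewrite <- (Rmult_0_r (2 * PI * T)), <- (I2_const T 0).
  unfold I2. apply RInt_extR. intros t.
  rewrite (RInt_primitive (g t)); auto using cont2_1.
  rewrite Hp, RInt_constR. ring.
Qed.

(** Differentiating the inner integral under the integral sign avoids exchanging the order of
    integration. *)
Lemma I2_dt T (g g' : R -> R -> R) : cont2 g -> cont2 g' ->
  (forall t x, is_derive (fun t => g t x) t (g' t x)) -> (forall x, g T x = g 0 x) ->
  I2 T g' = 0.
Proof.
  intros Hg Hc Hd Hp. unfold I2.
  rewrite (RInt_primitive (fun t => RInt (g t) 0 (2 * PI))).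
  - rewrite (RInt_extR (g T) (g 0)); [ring|]. intros x. apply Hp.
  - intros t. apply is_derive_RInt_param_C1; auto. intros; now apply cont2_1.
  - now apply cont2_inner.
Qed.

Lemma I2_ds T (f f' : R -> R -> R -> R) s : 0 < T ->
  cont3 f -> cont3 f' -> (forall s t x, is_derive (fun s => f s t x) s (f' s t x)) ->
  is_derive (fun s => I2 T (f s)) s (I2 T (f' s)).
Proof.
  intros HT Hf Hf' Hd. unfold I2.
  assert (H : forall h, cont3 h ->
    cont2 (fun s t => RInt (h s t) 0 (2 * PI))).
  { intros h Hh. apply cont2_intro.
    apply (continuous_RInt_param (U := prod_UniformSpace R_UniformSpace R_UniformSpace)
      (fun p => h (fst p) (snd p))).
    - pose proof two_PI_pos; lra.
    - intros p. apply (cont3_comp h (fun p => fst (fst p)) (fun p => snd (fst p)) snd); auto.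
      + apply (continuous_comp fst fst); apply continuous_fst.
      + apply (continuous_comp fst snd); [apply continuous_fst | apply continuous_snd].
      + apply continuous_snd. }
  apply (is_derive_RInt_param_C1 (fun s t => RInt (f s t) 0 (2 * PI))
           (fun s t => RInt (f' s t) 0 (2 * PI))).
  - intros u v. apply (is_derive_RInt_param_C1 (fun s x => f s v x) (fun s x => f' s v x)).
    + intros; apply Hd.
    + apply cont2_intro. intros p.
      apply (cont3_comp f' fst (fun _ => v) snd);
        first [assumption | apply continuous_const | apply continuous_fst | apply continuous_snd].
    + intros w. apply cont2_1, cont3_slice, Hf.
  - now apply H.
  - intros u. apply (cont2_1 (fun s t => RInt (f s t) 0 (2 * PI))). now apply H.
Qed.

Definition omega (T : R) (m : Z) : R := 2 * PI / T * IZR m.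

(* Letting the phase [al] vary treats cosine and sine coefficients at once; differentiation
   multiplies by the frequency and shifts the phase by [- PI / 2]. *)
Definition cf (T : R) (g : R -> R -> R) (m k : Z) (al : R) : R :=
  I2 T (fun t x => g t x * cos (omega T m * t + IZR k * x + al)).

Lemma continuous_ex_derive (f : R -> R) x : ex_derive f x -> continuous f x.
Proof. apply (ex_derive_continuous (V := R_NormedModule)). Qed.

Lemma cont2_wave a b c : cont2 (fun t x => cos (a * t + b * x + c)).
Proof.
  apply cont2_intro. intros p.
  apply (continuous_comp (fun p : R * R => a * fst p + b * snd p + c) cos).
  - apply (cont2_comp (fun t x => a * t + b * x + c) fst snd);
      [|apply continuous_fst | apply continuous_snd].
    apply cont2_plus; [apply cont2_plus|apply cont2_const];
      apply cont2_mult; try apply cont2_const.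
    + apply (cont2_fst (fun t => t)). intros; apply continuous_id.
    + apply (cont2_snd (fun t => t)). intros; apply continuous_id.
  - apply continuous_ex_derive. auto_derive. easy.
Qed.

Lemma cont2_wavel g a b c : cont2 g -> cont2 (fun t x => g t x * cos (a * t + b * x + c)).
Proof. intros H. apply cont2_mult; [exact H | apply cont2_wave]. Qed.

#[local] Hint Resolve cont2_wavel cont2_wave cont2_plus cont2_mult cont2_minus cont2_opp
  cont2_const cont3_slice : cont.

Lemma cf_ext T f g m k al : (forall t x, f t x = g t x) -> cf T f m k al = cf T g m k al.
Proof. intros H. apply I2_ext. intros. now rewrite H. Qed.

Lemma cf_plus T f g m k al : cont2 f -> cont2 g ->
  cf T (fun t x => f t x + g t x) m k al = cf T f m k al + cf T g m k al.
Proof.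
  intros Hf Hg. unfold cf. rewrite <- I2_plus by auto with cont.
  apply I2_ext. intros; ring.
Qed.

Lemma cf_scal T c f m k al : cont2 f ->
  cf T (fun t x => c * f t x) m k al = c * cf T f m k al.
Proof.
  intros Hf. unfold cf. rewrite <- I2_scal by auto with cont.
  apply I2_ext. intros; ring.
Qed.

Lemma cf_opp T f m k al : cont2 f ->
  cf T (fun t x => - f t x) m k al = - cf T f m k al.
Proof.
  intros Hf. rewrite (cf_ext T _ (fun t x => (-1) * f t x)) by (intros; ring).
  rewrite cf_scal by easy. ring.
Qed.

Lemma cf_minus T f g m k al : cont2 f -> cont2 g ->
  cf T (fun t x => f t x - g t x) m k al = cf T f m k al - cf T g m k al.
Proof.
  intros Hf Hg. rewrite (cf_plus T f (fun t x => - g t x)) by auto with cont.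
  rewrite cf_opp by easy. ring.
Qed.

Lemma Rabs_cos_le x : Rabs (cos x) <= 1.
Proof. apply Rabs_le. destruct (COS_bound x). lra. Qed.

Lemma cf_bound T g m k al M : 0 < T -> cont2 g -> (forall t x, Rabs (g t x) <= M) ->
  Rabs (cf T g m k al) <= 2 * PI * T * M.
Proof.
  intros HT Hg HM. rewrite <- I2_const. apply I2_abs; auto with cont.
  intros t x. rewrite Rabs_mult.
  specialize (HM t x). pose proof (Rabs_cos_le (omega T m * t + IZR k * x + al)).
  pose proof (Rabs_pos (g t x)). nra.
Qed.

(** The pointwise inequality |g| <= 1 + g ^ 2 stands in for Cauchy-Schwarz. A bound affine in the
    squared norm is what finite energy can integrate in s. *)
Lemma cf_bound_sqr T g h m k al : 0 < T -> cont2 g -> cont2 h ->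
  (forall t x, (g t x) ^ 2 <= h t x) ->
  Rabs (cf T g m k al) <= 2 * PI * T + I2 T h.
Proof.
  intros HT Hg Hh H.
  replace (2 * PI * T) with (I2 T (fun _ _ => 1)) by (rewrite I2_const; ring).
  rewrite <- I2_plus by auto with cont. apply I2_abs; auto with cont.
  intros t x. specialize (H t x). rewrite Rabs_mult.
  pose proof (Rabs_cos_le (omega T m * t + IZR k * x + al)) as H1.
  pose proof (Rabs_pos (g t x)) as H2. rewrite <- (pow2_abs (g t x)) in H.
  pose proof (Rabs_pos (cos (omega T m * t + IZR k * x + al))) as H3.
  nra.
Qed.

Lemma cos_period_Z y k : cos (y + 2 * PI * IZR k) = cos y.
Proof.
  destruct (Z.le_gt_cases 0 k) as [Hk|Hk].
  - rewrite <- (Z2Nat.id k Hk), <- INR_IZR_INZ, <- (cos_period y (Z.to_nat k)). f_equal. ring.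
  - rewrite <- (cos_period (y + 2 * PI * IZR k) (Z.to_nat (- k))).
    rewrite INR_IZR_INZ, Z2Nat.id, opp_IZR by lia. f_equal. ring.
Qed.

Lemma wave_period_x T m k al t :
  cos (omega T m * t + IZR k * (2 * PI) + al) = cos (omega T m * t + IZR k * 0 + al).
Proof. rewrite <- (cos_period_Z (omega T m * t + IZR k * 0 + al) k). f_equal. ring. Qed.

Lemma wave_period_t T m k al x : 0 < T ->
  cos (omega T m * T + IZR k * x + al) = cos (omega T m * 0 + IZR k * x + al).
Proof.
  intros HT. rewrite <- (cos_period_Z (omega T m * 0 + IZR k * x + al) m).
  f_equal. unfold omega. field. lra.
Qed.

Lemma cos_shift y : cos (y - PI / 2) = sin y.
Proof. rewrite cos_minus, cos_PI2, sin_PI2. ring. Qed.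

Lemma cf_dx T (g g' : R -> R -> R) m k al : cont2 g -> cont2 g' ->
  (forall t x, is_derive (g t) x (g' t x)) -> (forall t x, g t (x + 2 * PI) = g t x) ->
  cf T g' m k al = IZR k * cf T g m k (al - PI / 2).
Proof.
  intros Hg Hg' Hd Hp. unfold cf.
  set (A := fun t x => g' t x * cos (omega T m * t + IZR k * x + al)).
  set (B := fun t x => g t x * cos (omega T m * t + IZR k * x + (al - PI / 2))).
  assert (HA : cont2 A) by (unfold A; auto with cont).
  assert (HB : cont2 B) by (unfold B; auto with cont).
  assert (H : I2 T (fun t x => A t x + (- IZR k) * B t x) = 0).
  { apply (I2_dx T (fun t x => g t x * cos (omega T m * t + IZR k * x + al))).
    - auto with cont.
    - intros t x. unfold A, B. replace (omega T m * t + IZR k * x + (al - PI / 2))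
        with (omega T m * t + IZR k * x + al - PI / 2) by ring. rewrite cos_shift.
      evar_last.
      + apply (is_derive_mult (g t) (fun x => cos (omega T m * t + IZR k * x + al)));
          [apply Hd | auto_derive; [easy | reflexivity] | intros; apply Rmult_comm].
      + unfold plus, mult; simpl. ring.
    - intros t. rewrite wave_period_x. f_equal.
      rewrite <- (Hp t 0). f_equal. ring. }
  rewrite I2_plus, I2_scal in H by auto with cont. lra.
Qed.

Lemma cf_dt T (g g' : R -> R -> R) m k al : 0 < T -> cont2 g -> cont2 g' ->
  (forall t x, is_derive (fun t => g t x) t (g' t x)) -> (forall t x, g (t + T) x = g t x) ->
  cf T g' m k al = omega T m * cf T g m k (al - PI / 2).
Proof.
  intros HT Hg Hg' Hd Hp. unfold cf.
  set (A := fun t x => g' t x * cos (omega T m * t + IZR k * x + al)).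
  set (B := fun t x => g t x * cos (omega T m * t + IZR k * x + (al - PI / 2))).
  assert (HA : cont2 A) by (unfold A; auto with cont).
  assert (HB : cont2 B) by (unfold B; auto with cont).
  assert (H : I2 T (fun t x => A t x + (- omega T m) * B t x) = 0).
  { apply (I2_dt T (fun t x => g t x * cos (omega T m * t + IZR k * x + al))).
    - auto with cont.
    - auto with cont.
    - intros t x. unfold A, B. replace (omega T m * t + IZR k * x + (al - PI / 2))
        with (omega T m * t + IZR k * x + al - PI / 2) by ring. rewrite cos_shift.
      evar_last.
      + apply (is_derive_mult (fun t => g t x) (fun t => cos (omega T m * t + IZR k * x + al)));
          [apply Hd | auto_derive; [easy | reflexivity] | intros; apply Rmult_comm].
      + unfold plus, mult; simpl. ring.
    - intros x. rewrite wave_period_t by easy. f_equal.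
      rewrite <- (Hp 0 x). f_equal. ring. }
  rewrite I2_plus, I2_scal in H by auto with cont. lra.
Qed.

Lemma cf_ds T (f f' : R -> R -> R -> R) m k al s : 0 < T -> cont3 f -> cont3 f' ->
  (forall s t x, is_derive (fun s => f s t x) s (f' s t x)) ->
  is_derive (fun s => cf T (f s) m k al) s (cf T (f' s) m k al).
Proof.
  intros HT Hf Hf' Hd. unfold cf.
  assert (H : forall h, cont3 h ->
    cont3 (fun s t x => h s t x * cos (omega T m * t + IZR k * x + al))).
  { intros h Hh s0 t0 x0 eps He.
    assert (Hc : continuous (fun p : R * (R * R) => h (fst p) (fst (snd p)) (snd (snd p)) *
       cos (omega T m * fst (snd p) + IZR k * snd (snd p) + al)) (s0, (t0, x0))).
    { assert (H1 : continuous (fun p : R * (R * R) => fst (snd p)) (s0, (t0, x0)))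
        by (apply (continuous_comp snd fst); [apply continuous_snd | apply continuous_fst]).
      assert (H2 : continuous (fun p : R * (R * R) => snd (snd p)) (s0, (t0, x0)))
        by (apply (continuous_comp snd snd); apply continuous_snd).
      apply (continuous_mult (K := R_AbsRing) (fun p : R * (R * R) => h (fst p) (fst (snd p)) (snd (snd p)))).
      - apply (cont3_comp h fst); auto. apply continuous_fst.
      - apply (cont2_comp (fun t x => cos (omega T m * t + IZR k * x + al))
          (fun p : R * (R * R) => fst (snd p)) (fun p : R * (R * R) => snd (snd p))); auto with cont. }
    rewrite continuous_eps in Hc. destruct (Hc eps He) as [d Hd'].
    exists d. split; [apply cond_pos|]. intros s' t' x' H1 H2 H3.
    apply (Hd' (s', (t', x'))). repeat split; assumption. }
  apply (I2_ds T (fun s t x => f s t x * cos (omega T m * t + IZR k * x + al))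
     (fun s t x => f' s t x * cos (omega T m * t + IZR k * x + al))); auto.
  intros s' t x. evar_last.
  - apply (is_derive_mult (fun s => f s t x) (fun _ => cos (omega T m * t + IZR k * x + al)));
      [apply Hd | apply is_derive_const | intros; apply Rmult_comm].
  - unfold plus, mult, zero; simpl. ring.
Qed.

(** The two phases differ by a half period. This is i ^ 2 = -1 for the phase shift that replaces the
    imaginary unit. *)
Lemma cf_opp_phase T g m k al : cont2 g -> cf T g m k (al - PI / 2) = - cf T g m k (al + PI / 2).
Proof.
  intros Hg. unfold cf.
  replace (- I2 T (fun t x => g t x * cos (omega T m * t + IZR k * x + (al + PI / 2))))
    with (-1 * I2 T (fun t x => g t x * cos (omega T m * t + IZR k * x + (al + PI / 2)))) by ring.
  rewrite <- I2_scal by auto with cont.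
  apply I2_ext. intros t x.
  replace (omega T m * t + IZR k * x + (al + PI / 2))
    with (omega T m * t + IZR k * x + (al - PI / 2) + PI) by lra.
  rewrite neg_cos. ring.
Qed.

(** * Fejer's theorem *)

Fixpoint dirichlet (n : nat) (y : R) : R :=
  match n with O => 1 | S n => dirichlet n y + 2 * cos (INR (S n) * y) end.

(* [n] times the Fejer kernel *)
Fixpoint fejer (n : nat) (y : R) : R :=
  match n with O => 0 | S n => fejer n y + dirichlet n y end.

(** This closed form and the next one telescope. Keeping the factor 1 - cos y on the left avoids
    dividing at the multiples of the period. *)
Lemma dirichlet_cos n y :
  (1 - cos y) * dirichlet n y = cos (INR n * y) - cos (INR (S n) * y).
Proof.
  induction n as [|n IH].
  - simpl. rewrite Rmult_0_l, cos_0, Rmult_1_l. ring.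
  - change (dirichlet (S n) y) with (dirichlet n y + 2 * cos (INR (S n) * y)).
    rewrite Rmult_plus_distr_l, IH. rewrite (S_INR (S n)).
    replace (INR n * y) with (INR (S n) * y - y) by (rewrite S_INR; ring).
    replace ((INR (S n) + 1) * y) with (INR (S n) * y + y) by ring.
    rewrite cos_minus, cos_plus. ring.
Qed.

Lemma fejer_cos n y : (1 - cos y) * fejer n y = 1 - cos (INR n * y).
Proof.
  induction n as [|n IH].
  - simpl. rewrite Rmult_0_l, cos_0. ring.
  - change (fejer (S n) y) with (fejer n y + dirichlet n y).
    rewrite Rmult_plus_distr_l, IH, dirichlet_cos. ring.
Qed.

Lemma cos_mult_1 n y : cos y = 1 -> cos (INR n * y) = 1.
Proof.
  intros H.
  assert (Hs : sin y = 0).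
  { apply Rsqr_eq_0. pose proof (sin2_cos2 y). rewrite H in *. unfold Rsqr in *. lra. }
  induction n as [|n IH].
  - simpl. rewrite Rmult_0_l. apply cos_0.
  - rewrite S_INR, Rmult_plus_distr_r, Rmult_1_l, cos_plus, IH, H, Hs. ring.
Qed.

Lemma fejer_nonneg n y : 0 <= fejer n y.
Proof.
  destruct (Req_dec (cos y) 1) as [H|H].
  (* Here the closed form reads 0 = 0; instead every cosine in the sum equals 1. *)
  - assert (Hd : forall k, 0 <= dirichlet k y).
    { induction k as [|k IH]; [simpl; lra|].
      change (dirichlet (S k) y) with (dirichlet k y + 2 * cos (INR (S k) * y)).
      rewrite cos_mult_1 by easy. lra. }
    induction n as [|n IH]; [simpl; lra|]. simpl. specialize (Hd n). lra.
  - pose proof (fejer_cos n y) as H1. destruct (COS_bound y) as [_ H2].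
    destruct (COS_bound (INR n * y)) as [_ H3]. nra.
Qed.

Lemma continuous_dirichlet n a b y : continuous (fun y => dirichlet n (a * (y - b))) y.
Proof.
  induction n as [|n IH].
  - apply continuous_const.
  - apply (continuous_plus (fun y => dirichlet n (a * (y - b)))
      (fun y => 2 * cos (INR (S n) * (a * (y - b))))); [exact IH|].
    apply continuous_ex_derive. auto_derive. easy.
Qed.

Lemma continuous_fejer n a b y : continuous (fun y => fejer n (a * (y - b))) y.
Proof.
  induction n as [|n IH].
  - apply continuous_const.
  - apply (continuous_plus (fun y => fejer n (a * (y - b)))
      (fun y => dirichlet n (a * (y - b)))); [exact IH|]. apply continuous_dirichlet.
Qed.

Lemma periodic_Z (h : R -> R) L (Hh : forall y, h (y + L) = h y) k y :
  h (y + L * IZR k) = h y.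
Proof.
  assert (H : forall n z, h (z + L * INR n) = h z).
  { induction n as [|n IH]; intros z.
    - simpl. f_equal. ring.
    - rewrite <- (IH z), <- (Hh (z + L * INR n)), S_INR. f_equal. ring. }
  destruct (Z.le_gt_cases 0 k) as [Hk|Hk].
  - rewrite <- (Z2Nat.id k Hk), <- INR_IZR_INZ. apply H.
  - rewrite <- (H (Z.to_nat (- k))). rewrite INR_IZR_INZ, Z2Nat.id, opp_IZR by lia.
    f_equal. ring.
Qed.

Lemma period_shift L y : 0 < L -> exists k, 0 <= y + L * IZR k < L.
Proof.
  intros HL. exists (- Int_part (y / L))%Z. rewrite opp_IZR.
  destruct (base_Int_part (y / L)) as [H1 H2].
  assert (y = L * (y / L)) by (field; lra). split; nra.
Qed.

Lemma periodic_bounded (h : R -> R) L : 0 < L -> (forall y, h (y + L) = h y) ->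
  (forall y, continuous h y) -> exists M, forall y, Rabs (h y) <= M.
Proof.
  intros HL Hp Hc.
  destruct (continuity_ab_maj (fun y => Rabs (h y)) 0 L) as (z & Hz & _); [lra | |].
  { intros c _. apply continuity_pt_filterlim.
    apply (continuous_comp h Rabs); [apply Hc | apply continuous_Rabs]. }
  exists (Rabs (h z)). intros y. destruct (period_shift L y HL) as [k Hk].
  rewrite <- (periodic_Z h L Hp k y). apply Hz. lra.
Qed.

(* Equations produced by [RInt] lemmas live in the carrier of a normed module, where [ring] and
   [field] do not find the ring structure of [R]. *)
Ltac as_real_eq := match goal with |- @eq _ ?a ?b => change (@eq R a b) end.

Lemma RInt_dirichlet L x n : 0 < L ->
  RInt (fun y => dirichlet n (2 * PI / L * (y - x))) 0 L = L.
Proof.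
  intros HL. pose proof PI_RGT_0 as HP.
  assert (Hn : 0 < 2 * PI / L) by (apply Rdiv_lt_0_compat; lra).
  induction n as [|n IH].
  - simpl. rewrite RInt_constR. ring.
  - set (nu := 2 * PI / L) in *.
    rewrite (RInt_extR _ (fun y => dirichlet n (nu * (y - x)) +
       2 * cos (INR (S n) * (nu * (y - x))))) by reflexivity.
    assert (Hcc : forall y, continuous (fun y => 2 * cos (INR (S n) * (nu * (y - x)))) y)
      by (intros y; apply continuous_ex_derive; auto_derive; easy).
    rewrite RInt_plusR, IH;
      try (apply ex_RInt_cont; first [exact Hcc | intros; apply continuous_dirichlet]).
    assert (HS : 0 < INR (S n)) by (apply lt_0_INR; lia).
    assert (HNnu : INR (S n) * (nu * (L - x)) =
        INR (S n) * (nu * (0 - x)) + 2 * INR (S n) * PI) by (unfold nu; field; lra).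
    rewrite (RInt_primitive
      (fun y => 2 / (INR (S n) * nu) * sin (INR (S n) * (nu * (y - x))))); [| |exact Hcc].
    + rewrite HNnu, sin_period. as_real_eq. ring.
    + intros y. revert HS. generalize (INR (S n)). intros N HS.
      auto_derive; [easy|]. as_real_eq. unfold Rminus. field. lra.
Qed.

Lemma RInt_fejer L x n : 0 < L ->
  RInt (fun y => fejer n (2 * PI / L * (y - x))) 0 L = INR n * L.
Proof.
  intros HL. induction n as [|n IH].
  - simpl. rewrite RInt_constR. ring.
  - rewrite (RInt_extR _ (fun y => fejer n (2 * PI / L * (y - x)) +
       dirichlet n (2 * PI / L * (y - x)))) by reflexivity.
    rewrite RInt_plusR, IH, (RInt_dirichlet L x n HL);
      try (apply ex_RInt_cont; intros; first [apply continuous_fejer | apply continuous_dirichlet]).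
    rewrite S_INR. as_real_eq. ring.
Qed.

Lemma continuous_multR (f g : R -> R) x :
  continuous f x -> continuous g x -> continuous (fun x => f x * g x) x.
Proof. apply (continuous_mult (K := R_AbsRing)). Qed.

(** The kernel tests h against finitely many waves, with total at most B (1 + 2 sum 1 / (1 + j ^
    2)). The factor 5 - 4 / (n + 1) is a telescoping majorant of that sum: it equals 1 at n = 0 and
    its increments 4 / ((n + 1) (n + 2)) dominate the terms. *)
Lemma RInt_mul_dirichlet h L B x n : 0 < L -> (forall y, continuous h y) ->
  (forall (j : nat) al, Rabs (RInt (fun y => h y * cos (2 * PI / L * INR j * y + al)) 0 L)
     <= B / (1 + INR j ^ 2)) ->
  Rabs (RInt (fun y => h y * dirichlet n (2 * PI / L * (y - x))) 0 L)
    <= B * (5 - 4 / (INR n + 1)).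
Proof.
  intros HL Hc H. set (nu := 2 * PI / L) in *.
  assert (HB : 0 <= B).
  { specialize (H O 0). simpl in H.
    match type of H with Rabs ?a <= _ => pose proof (Rabs_pos a) end.
    replace (B / (1 + 0 * (0 * 1))) with B in H by field. lra. }
  induction n as [|n IH].
  - specialize (H O 0). simpl in *. replace (B * (5 - 4 / (0 + 1))) with (B / (1 + 0 * (0 * 1))) by field.
    rewrite (RInt_extR _ (fun y => h y * cos (nu * 0 * y + 0))); [exact H|].
    intros y. replace (nu * 0 * y + 0) with 0 by ring. now rewrite cos_0.
  - specialize (H (S n) (- (nu * INR (S n) * x))).
    rewrite (RInt_extR _ (fun y => h y * dirichlet n (nu * (y - x)) +
      2 * (h y * cos (nu * INR (S n) * y + - (nu * INR (S n) * x))))).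
    2: { intros y. replace (nu * INR (S n) * y + - (nu * INR (S n) * x))
           with (INR (S n) * (nu * (y - x))) by ring.
         change (dirichlet (S n) (nu * (y - x)))
           with (dirichlet n (nu * (y - x)) + 2 * cos (INR (S n) * (nu * (y - x)))). ring. }
    assert (Hcc : forall y, continuous (fun y => h y * cos (nu * INR (S n) * y + - (nu * INR (S n) * x))) y).
    { intros y. apply continuous_multR; [apply Hc|]. apply continuous_ex_derive.
      auto_derive. easy. }
    rewrite RInt_plusR, RInt_scalR.
    + eapply Rle_trans; [apply Rabs_triang|]. rewrite Rabs_mult, (Rabs_pos_eq 2) by lra.
      apply Rle_trans with (B * (5 - 4 / (INR n + 1)) + 2 * (B / (1 + INR (S n) ^ 2))); [lra|].
      rewrite S_INR. pose proof (pos_INR n) as Hn. set (a := INR n) in *.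
      assert (2 / (1 + (a + 1) ^ 2) <= 4 / (a + 1) - 4 / (a + 1 + 1)).
      { replace (4 / (a + 1) - 4 / (a + 1 + 1)) with (4 / ((a + 1) * (a + 2)))
          by (field; lra).
        apply (Rmult_le_reg_r ((1 + (a + 1) ^ 2) * ((a + 1) * (a + 2)))); [nra|].
        field_simplify; nra. }
      replace (2 * (B / (1 + (a + 1) ^ 2))) with (B * (2 / (1 + (a + 1) ^ 2)))
        by (field; nra). nra.
    + now apply ex_RInt_cont.
    + apply ex_RInt_cont. intros y. apply continuous_multR; [apply Hc | apply continuous_dirichlet].
    + apply ex_RInt_cont. intros y. apply continuous_multR; [apply continuous_const | apply Hcc].
Qed.

Lemma RInt_mul_fejer h L B x n : 0 < L -> (forall y, continuous h y) ->
  (forall (j : nat) al, Rabs (RInt (fun y => h y * cos (2 * PI / L * INR j * y + al)) 0 L)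
     <= B / (1 + INR j ^ 2)) ->
  Rabs (RInt (fun y => h y * fejer n (2 * PI / L * (y - x))) 0 L) <= 5 * B * INR n.
Proof.
  intros HL Hc H.
  assert (HB : 0 <= B).
  { specialize (H O 0). simpl in H.
    match type of H with Rabs ?a <= _ => pose proof (Rabs_pos a) end.
    replace (B / (1 + 0 * (0 * 1))) with B in H by field. lra. }
  induction n as [|n IH].
  - simpl. rewrite (RInt_extR _ (fun _ => 0)) by (intros; ring).
    rewrite RInt_constR, Rmult_0_r, Rabs_R0. lra.
  - rewrite (RInt_extR _ (fun y => h y * fejer n (2 * PI / L * (y - x)) +
       h y * dirichlet n (2 * PI / L * (y - x)))) by (intros; simpl fejer; ring).
    rewrite RInt_plusR.
    + eapply Rle_trans; [apply Rabs_triang|].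
      pose proof (RInt_mul_dirichlet h L B x n HL Hc H).
      pose proof (pos_INR n). assert (0 < 4 / (INR n + 1)) by (apply Rdiv_lt_0_compat; lra).
      rewrite S_INR. nra.
    + apply ex_RInt_cont. intros y. apply continuous_multR; [apply Hc | apply continuous_fejer].
    + apply ex_RInt_cont. intros y. apply continuous_multR; [apply Hc | apply continuous_dirichlet].
Qed.

(** The cosine decreases on the first half period, and the second half is its mirror image under u
    -> L - u. *)
Lemma cos_away_1 nu d u L : nu = 2 * PI / L -> 0 < L -> 0 < d <= L / 2 -> d <= u <= L - d ->
  cos (nu * u) <= cos (nu * d).
Proof.
  intros Hnu HL Hd Hu. pose proof PI_RGT_0 as HP.
  assert (H0 : 0 < nu) by (rewrite Hnu; apply Rdiv_lt_0_compat; lra).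
  assert (H1 : nu * L = 2 * PI) by (rewrite Hnu; field; lra).
  destruct (Rle_lt_dec u (L / 2)) as [H|H].
  - apply cos_decr_1; nra.
  - replace (cos (nu * u)) with (cos (nu * (L - u))).
    + apply cos_decr_1; nra.
    + rewrite <- (cos_neg (nu * u)), <- (cos_period (- (nu * u)) 1). f_equal. simpl. nra.
Qed.

(* The weight [1 - cos] vanishes only at multiples of the period, so that it controls the
   oscillation of [h] away from [x]; multiplied by the Fejer kernel it stays bounded. *)
Lemma oscillation_bound h L x eps : 0 < L -> (forall y, h (y + L) = h y) ->
  (forall y, continuous h y) -> 0 <= x <= L -> 0 < eps ->
  exists M, 0 <= M /\ forall y, 0 <= y <= L ->
    Rabs (h y - h x) <= eps + M * (1 - cos (2 * PI / L * (y - x))).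
Proof.
  intros HL Hp Hc Hx He.
  destruct (periodic_bounded h L HL Hp Hc) as [H HH].
  assert (H0 : 0 <= H) by (apply Rle_trans with (1 := Rabs_pos (h 0)); apply HH).
  pose proof (proj1 (continuous_eps h x) (Hc x) eps He) as [d0 Hd0].
  set (d := Rmin d0 (L / 2)).
  assert (Hd : 0 < d <= L / 2).
  { split; [apply Rmin_glb_lt; [apply cond_pos | lra] | apply Rmin_r]. }
  assert (Hdd : forall y, Rabs (y - x) < d -> Rabs (h y - h x) < eps).
  { intros y Hy. apply Hd0. apply Rlt_le_trans with (1 := Hy). apply Rmin_l. }
  set (nu := 2 * PI / L). pose proof PI_RGT_0 as HP.
  assert (Hnu : 0 < nu) by (unfold nu; apply Rdiv_lt_0_compat; lra).
  assert (HnL : nu * L = 2 * PI) by (unfold nu; field; lra).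
  assert (Hc1 : cos (nu * d) < 1).
  { rewrite <- cos_0. apply cos_decreasing_1; nra. }
  exists (2 * H / (1 - cos (nu * d))).
  assert (HM : 0 <= 2 * H / (1 - cos (nu * d))) by (apply Rdiv_le_0_compat; lra).
  split; [exact HM|]. intros y Hy.
  destruct (COS_bound (nu * (y - x))) as [_ Hb].
  assert (Hsmall : Rabs (h y - h x) < eps -> Rabs (h y - h x) <=
     eps + 2 * H / (1 - cos (nu * d)) * (1 - cos (nu * (y - x)))) by (intros; nra).
  assert (Hbig : cos (nu * (y - x)) <= cos (nu * d) -> Rabs (h y - h x) <=
     eps + 2 * H / (1 - cos (nu * d)) * (1 - cos (nu * (y - x)))).
  { intros H1.
    assert (H2 : 2 * H = 2 * H / (1 - cos (nu * d)) * (1 - cos (nu * d))) by (field; lra).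
    assert (H3 : Rabs (h y - h x) <= 2 * H).
    { unfold Rminus. eapply Rle_trans; [apply Rabs_triang|]. rewrite Rabs_Ropp.
      pose proof (HH x). pose proof (HH y). lra. }
    nra. }
  destruct (Rlt_le_dec (Rabs (y - x)) d) as [H1|H1]; [now apply Hsmall, Hdd|].
  destruct (Rle_lt_dec x y) as [Hxy|Hxy].
  - rewrite Rabs_pos_eq in H1 by lra.
    destruct (Rle_lt_dec (y - x) (L - d)) as [H2|H2].
    + apply Hbig. apply cos_away_1 with L; auto.
    (* Now y - L lies within d of x, so periodicity reduces to the near case. *)
    + apply Hsmall. replace y with (y - L + L) by ring. rewrite Hp. apply Hdd.
      apply Rabs_lt_between. lra.
  - rewrite Rabs_left1 in H1 by lra.
    destruct (Rle_lt_dec (x - y) (L - d)) as [H2|H2].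
    + apply Hbig. rewrite <- (cos_neg (nu * (y - x))).
      replace (- (nu * (y - x))) with (nu * (x - y)) by ring. apply cos_away_1 with L; auto; lra.
    + apply Hsmall. rewrite <- Hp. apply Hdd. apply Rabs_lt_between. lra.
Qed.

(** Integrate h against n times the Fejer kernel centred at x. The coefficient bounds give at most 5
    B n. On the other hand the integral is h x * n L up to eps * n L + 2 M L, because (1 - cos)
    times the kernel is at most 2. If |h x| exceeded 5 B / L, a large n would contradict this. *)
Lemma fourier_sup h L B : 0 < L -> (forall y, h (y + L) = h y) ->
  (forall y, continuous h y) ->
  (forall (j : nat) al, Rabs (RInt (fun y => h y * cos (2 * PI / L * INR j * y + al)) 0 L)
     <= B / (1 + INR j ^ 2)) ->
  forall x, Rabs (h x) <= 5 * B / L.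
Proof.
  intros HL Hp Hc H.
  enough (Hx0 : forall x, 0 <= x <= L -> Rabs (h x) <= 5 * B / L).
  { intros x. destruct (period_shift L x HL) as [k Hk].
    rewrite <- (periodic_Z h L Hp k x). apply Hx0. lra. }
  intros x Hx. apply Rnot_lt_le. intros Hlt.
  assert (Hg : 0 < Rabs (h x) * L - 5 * B).
  { apply (Rmult_lt_compat_r L) in Hlt; [|lra]. field_simplify in Hlt; lra. }
  set (gap := Rabs (h x) * L - 5 * B) in *. set (eps := gap / (2 * L)).
  assert (He : 0 < eps) by (apply Rdiv_lt_0_compat; lra).
  destruct (oscillation_bound h L x eps HL Hp Hc Hx He) as (M & HM & Hosc).
  (* Half of the gap pays for the error eps * n L; this n makes the other half exceed the remaining
     error 2 M L. *)
  destruct (INR_archimed (gap / 2) (2 * M * L)) as [n Hn]; [lra|].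
  set (nu := 2 * PI / L) in *.
  set (K := fun y => fejer n (nu * (y - x))).
  assert (HK : forall y, continuous K y) by (intros; apply continuous_fejer).
  assert (HhK : forall y, continuous (fun y => h y * K y) y) by (intros; now apply continuous_multR).
  assert (H1 : Rabs (RInt (fun y => h y * K y + (- h x) * K y) 0 L) <= eps * (INR n * L) + 2 * M * L).
  { apply Rle_trans with (RInt (fun y => eps * K y + M * (1 - cos (INR n * (nu * (y - x))))) 0 L).
    - assert (E1 : ex_RInt (fun y => h y * K y + (- h x) * K y) 0 L).
      { apply ex_RInt_cont. intros y. apply (continuous_plus (fun y => h y * K y)); auto.
        apply continuous_multR; [apply continuous_const | apply HK]. }
      assert (E2 : forall y, continuous (fun y => eps * K y + M * (1 - cos (INR n * (nu * (y - x))))) y).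
      { intros y. apply (continuous_plus (fun y => eps * K y)).
        - apply continuous_multR; [apply continuous_const | apply HK].
        - apply continuous_ex_derive. auto_derive. easy. }
      eapply Rle_trans; [apply abs_RInt_le; [lra | exact E1]|].
      apply RInt_le; [lra | | now apply ex_RInt_cont |].
      + apply ex_RInt_cont. intros y. apply (continuous_comp _ Rabs); [|apply continuous_Rabs].
        apply (continuous_plus (fun y => h y * K y)); auto.
        apply continuous_multR; [apply continuous_const | apply HK].
      + intros y Hy.
        replace (h y * K y + - h x * K y) with ((h y - h x) * K y) by ring.
        rewrite <- fejer_cos. fold (K y).
        assert (HKy : 0 <= K y) by apply fejer_nonneg.
        rewrite Rabs_mult, (Rabs_pos_eq (K y)) by easy.
        assert (Hyo := Hosc y ltac:(lra)). nra.
    - rewrite RInt_plusR, RInt_scalR.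
      + unfold K, nu. rewrite RInt_fejer by easy. apply Rplus_le_compat_l.
        eapply Rle_trans; [apply Rle_abs|].
        replace (2 * M * L) with ((L - 0) * (2 * M)) by ring.
        apply abs_RInt_le_const; [lra | |].
        * apply ex_RInt_cont. intros. apply continuous_ex_derive. auto_derive. easy.
        * intros y _. destruct (COS_bound (INR n * (2 * PI / L * (y - x)))).
          rewrite Rabs_pos_eq; nra.
      + now apply ex_RInt_cont.
      + apply ex_RInt_cont. intros. apply continuous_multR; [apply continuous_const | apply HK].
      + apply ex_RInt_cont. intros. apply continuous_ex_derive. auto_derive. easy. }
  pose proof (RInt_mul_fejer h L B x n HL Hc H) as H2. fold nu in H2. fold K in H2.
  rewrite RInt_plusR, RInt_scalR in H1; try (now apply ex_RInt_cont).
  2: { apply ex_RInt_cont. intros. apply continuous_multR; [apply continuous_const | apply HK]. }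
  assert (HRK : RInt K 0 L = INR n * L) by (unfold K, nu; now apply RInt_fejer).
  change (RInt (fun y => K y) 0 L) with (RInt K 0 L) in H1. rewrite HRK in H1.
  change (RInt (fun y => h y * fejer n (nu * (y - x))) 0 L)
    with (RInt (fun y => h y * K y) 0 L) in H2.
  set (I := RInt (fun y => h y * K y) 0 L) in *.
  assert (H3 : Rabs (h x) * (INR n * L) <= 5 * B * INR n + eps * (INR n * L) + 2 * M * L).
  { pose proof (pos_INR n) as Hn0.
    rewrite <- (Rabs_pos_eq (INR n * L)) at 1 by (apply Rmult_le_pos; lra). rewrite <- Rabs_mult.
    replace (h x * (INR n * L)) with (I + - (I + - h x * (INR n * L))) by ring.
    eapply Rle_trans; [apply Rabs_triang|]. rewrite Rabs_Ropp. lra. }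
  assert (H4 : eps * (INR n * L) = gap / 2 * INR n) by (unfold eps; field; lra).
  unfold gap in *. nra.
Qed.

(** Product-to-sum formula: an iterated one-dimensional coefficient is the mean of the torus
    coefficients at (m, k) and (m, - k). *)
Lemma RInt_cf_split T g (m k : Z) al be : cont2 g ->
  RInt (fun t => RInt (fun x => g t x * cos (IZR k * x + be)) 0 (2 * PI) * cos (omega T m * t + al)) 0 T
  = / 2 * (cf T g m k (al + be) + cf T g m (- k) (al - be)).
Proof.
  intros Hg. unfold cf. rewrite <- I2_plus, <- I2_scal by auto with cont.
  unfold I2. apply RInt_extR. intros t.
  rewrite Rmult_comm, <- RInt_scalR.
  - apply RInt_extR. intros x. rewrite opp_IZR.
    replace (omega T m * t + IZR k * x + (al + be)) with ((omega T m * t + al) + (IZR k * x + be)) by ring.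
    replace (omega T m * t + - IZR k * x + (al - be)) with ((omega T m * t + al) - (IZR k * x + be)) by ring.
    generalize (omega T m * t + al) (IZR k * x + be). intros a b. rewrite cos_plus, cos_minus. field.
  - apply ex_RInt_cont. intros x. apply continuous_multR; [now apply cont2_1|].
    apply continuous_ex_derive. auto_derive. easy.
Qed.

(** The product form lets a bound by 1 / weight split into one summable factor per variable. *)
Definition weight (m k : Z) : R := (1 + IZR m ^ 2) * (1 + IZR k ^ 2).

(** The one-dimensional estimate is used twice: in x at fixed t, and then in t on each
    x-coefficient, itself a periodic function of t. Each use costs a factor 5. *)
Lemma fourier_sup2 T g B : 0 < T -> cont2 g ->
  (forall t x, g (t + T) x = g t x) -> (forall t x, g t (x + 2 * PI) = g t x) ->
  (forall m k al, Rabs (cf T g m k al) <= B / weight m k) ->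
  forall t x, Rabs (g t x) <= 25 * B / (2 * PI * T).
Proof.
  intros HT Hg HpT Hpx H t. pose proof PI_RGT_0 as HP.
  replace (25 * B / (2 * PI * T)) with (5 * (5 * B / T) / (2 * PI)) by (field; lra).
  apply fourier_sup; auto using cont2_1; [lra|].
  intros j be. replace (2 * PI / (2 * PI)) with 1 by (field; lra).
  set (h := fun t => RInt (fun x => g t x * cos (1 * INR j * x + be)) 0 (2 * PI)).
  replace (5 * B / T / (1 + INR j ^ 2)) with (5 * (B / (1 + INR j ^ 2)) / T)
    by (field; pose proof (pow2_ge_0 (INR j)); lra).
  apply (fourier_sup h); auto.
  - intros u. apply RInt_extR. intros x. now rewrite HpT.
  - intros u. apply (cont2_inner (fun t x => g t x * cos (1 * INR j * x + be))).
    apply cont2_mult; auto. apply cont2_snd. intros. apply continuous_ex_derive.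
    auto_derive. easy.
  - intros m al.
    rewrite (RInt_extR _ (fun t => RInt (fun x => g t x * cos (IZR (Z.of_nat j) * x + be)) 0 (2 * PI)
       * cos (omega T (Z.of_nat m) * t + al))).
    + rewrite RInt_cf_split by easy.
      pose proof (H (Z.of_nat m) (Z.of_nat j) (al + be)) as H1.
      pose proof (H (Z.of_nat m) (- Z.of_nat j)%Z (al - be)) as H2.
      assert (Hw1 : B / weight (Z.of_nat m) (Z.of_nat j) = B / (1 + INR j ^ 2) / (1 + INR m ^ 2)).
      { unfold weight. rewrite <- !INR_IZR_INZ. field. pose proof (pow2_ge_0 (INR j)).
        pose proof (pow2_ge_0 (INR m)). lra. }
      assert (Hw2 : weight (Z.of_nat m) (- Z.of_nat j) = weight (Z.of_nat m) (Z.of_nat j)).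
      { unfold weight. rewrite opp_IZR. ring. }
      rewrite Hw2, Hw1 in H2. rewrite Hw1 in H1.
      rewrite Rabs_mult, (Rabs_pos_eq (/ 2)) by lra.
      eapply Rle_trans; [apply Rmult_le_compat_l; [lra | apply Rabs_triang]|]. lra.
    + intros u. unfold h, omega. rewrite <- !INR_IZR_INZ. f_equal.
      apply RInt_extR. intros x. do 3 f_equal. ring.
Qed.

(** * Small divisors and the scalar equation *)

Lemma weight_ge_1 m k : 1 <= weight m k.
Proof. unfold weight. pose proof (pow2_ge_0 (IZR m)). pose proof (pow2_ge_0 (IZR k)). nra. Qed.

Lemma Rabs_le_sqr a : Rabs a <= 1 + a ^ 2.
Proof. rewrite <- (pow2_abs a). pose proof (Rabs_pos a). nra. Qed.

Lemma weight_ge_l m k : 1 + IZR m ^ 2 <= weight m k.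
Proof. unfold weight. pose proof (pow2_ge_0 (IZR m)). pose proof (pow2_ge_0 (IZR k)). nra. Qed.

Lemma weight_ge_r m k : 1 + IZR k ^ 2 <= weight m k.
Proof. unfold weight. pose proof (pow2_ge_0 (IZR m)). pose proof (pow2_ge_0 (IZR k)). nra. Qed.

Lemma irr_exponent_lt r mu eps : irrationality_measure_eq r mu -> 0 < eps ->
  exists nu, nu < mu + eps /\ irr_exponents r nu.
Proof.
  intros [_ H] He. apply NNPP. intros Hn.
  enough (mu + eps <= mu) by lra. apply H. intros nu Hnu.
  apply Rnot_lt_le. intros Hlt. apply Hn. eauto.
Qed.

Definition disp (k : Z) : R := sqrt (1 + IZR k ^ 2).

Lemma disp_sqr k : disp k * disp k = 1 + IZR k ^ 2.
Proof. apply sqrt_sqrt. pose proof (pow2_ge_0 (IZR k)). lra. Qed.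

Lemma disp_ge_1 k : 1 <= disp k.
Proof.
  rewrite <- sqrt_1. apply sqrt_le_1; pose proof (pow2_ge_0 (IZR k)); lra.
Qed.

Lemma disp_ge_k k : Rabs (IZR k) <= disp k.
Proof.
  pose proof (disp_sqr k). pose proof (disp_ge_1 k). pose proof (Rabs_pos (IZR k)).
  pose proof (pow2_abs (IZR k)). nra.
Qed.

Lemma disp_le k : disp k <= 1 + IZR k ^ 2.
Proof. pose proof (disp_sqr k). pose proof (disp_ge_1 k). nra. Qed.

(** Multiply by the conjugate e omega - d disp. The product is, up to sign, omega ^ 2 - Q with Q = 1
    + k ^ 2, that is w ^ 2 Q times the distance from (T / 2 pi) ^ 2 to m ^ 2 / Q. An exponent below
    3 bounds this from below by w ^ 2 c / Q ^ 2, and the conjugate is at most (1 + w) weight, whence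
    the third power. *)
Lemma small_divisor T : 0 < T -> irrationality_measure_eq ((T / (2 * PI)) ^ 2) 2 ->
  exists c, 0 < c /\ forall m k e d, e ^ 2 = 1 -> d ^ 2 = 1 ->
    c / weight m k ^ 3 <= Rabs (e * omega T m + d * disp k).
Proof.
  intros HT Hirr. pose proof PI_RGT_0 as HP.
  destruct (irr_exponent_lt _ _ 1 Hirr Rlt_0_1) as (nu & Hnu & c & Hc & H).
  set (w := 2 * PI / T). assert (Hw : 0 < w) by (apply Rdiv_lt_0_compat; lra).
  assert (Hw2 : 0 < w ^ 2) by now apply pow_lt.
  assert (Hwc : 0 < w ^ 2 * c) by now apply Rmult_lt_0_compat.
  exists (w ^ 2 * c / (1 + w)). split; [apply Rdiv_lt_0_compat; lra|].
  intros m k e d He Hd.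
  assert (Hq : exists q : nat, (0 < q)%nat /\ INR q = 1 + IZR k ^ 2).
  { exists (Z.to_nat (1 + k * k)). split; [nia|].
    rewrite INR_IZR_INZ, Z2Nat.id, plus_IZR, mult_IZR by nia. ring. }
  destruct Hq as (q & Hq0 & Hq).
  specialize (H (m * m)%Z q Hq0). rewrite Hq, mult_IZR in H.
  set (Q := 1 + IZR k ^ 2) in *.
  assert (HQ : 1 <= Q) by (unfold Q; pose proof (pow2_ge_0 (IZR k)); lra).
  assert (H1 : c / Q ^ 3 <= c / Rpower Q nu).
  { apply Rmult_le_compat_l; [lra|]. apply Rinv_le_contravar; [apply exp_pos|].
    rewrite <- Rpower_pow by lra. apply Rle_Rpower; simpl; lra. }
  assert (H2 : w ^ 2 * c / Q ^ 2 <= Rabs ((omega T m) ^ 2 - Q)).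
  { replace ((omega T m) ^ 2 - Q) with
      (w ^ 2 * Q * - ((T / (2 * PI)) ^ 2 - IZR m * IZR m / Q))
      by (unfold omega, w; field; lra).
    rewrite Rabs_mult, Rabs_Ropp, Rabs_pos_eq by nra.
    replace (w ^ 2 * c / Q ^ 2) with (w ^ 2 * Q * (c / Q ^ 3)) by (field; lra).
    apply Rmult_le_compat_l; [nra | lra]. }
  set (E := disp k) in *. pose proof (disp_ge_1 k) as HE1. pose proof (disp_le k) as HE2.
  pose proof (disp_sqr k) as HE3. fold E in HE1, HE2, HE3. fold Q in HE2, HE3.
  assert (He1 : Rabs e = 1 /\ Rabs d = 1).
  { pose proof (Rabs_pos e). pose proof (Rabs_pos d).
    rewrite <- pow2_abs in He, Hd. split; nra. }
  assert (H3 : Rabs ((omega T m) ^ 2 - Q) =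
     Rabs (e * omega T m + d * E) * Rabs (e * omega T m + - d * E)).
  { rewrite <- Rabs_mult. f_equal.
    replace ((e * omega T m + d * E) * (e * omega T m + - d * E))
      with (e ^ 2 * (omega T m) ^ 2 - d ^ 2 * (E * E)) by ring. rewrite He, Hd, HE3. ring. }
  assert (H4 : Rabs (e * omega T m + - d * E) <= (1 + w) * weight m k).
  { eapply Rle_trans; [apply Rabs_triang|].
    rewrite !Rabs_mult, Rabs_Ropp, (proj1 He1), (proj2 He1), (Rabs_pos_eq E) by lra.
    unfold omega. fold w. rewrite Rabs_mult, (Rabs_pos_eq w) by lra.
    pose proof (Rabs_le_sqr (IZR m)) as A1. pose proof (weight_ge_l m k) as A2.
    pose proof (weight_ge_r m k) as A3. fold Q in A3.
    assert (w * Rabs (IZR m) <= w * weight m k) by (apply Rmult_le_compat_l; lra). lra. }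
  assert (HW : Q <= weight m k) by apply weight_ge_r.
  set (W := weight m k) in *.
  assert (H5 : w ^ 2 * c / W ^ 2 <= w ^ 2 * c / Q ^ 2).
  { apply Rmult_le_compat_l; [nra|]. apply Rinv_le_contravar; nra. }
  set (A := Rabs (e * omega T m + d * E)) in *.
  assert (HA : 0 <= A) by apply Rabs_pos.
  assert (H6 : w ^ 2 * c / W ^ 2 <= A * ((1 + w) * W)) by nra.
  assert (HW0 : 0 < (1 + w) * W) by nra.
  apply (Rmult_le_reg_r ((1 + w) * W)); [lra|].
  replace (w ^ 2 * c / (1 + w) / W ^ 3 * ((1 + w) * W)) with (w ^ 2 * c / W ^ 2)
    by (field; lra). exact H6.
Qed.

(** * The scalar equation with nearly constant forcing *)

Lemma decreasing_of_derive (h dh : R -> R) a b : a <= b ->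
  (forall x, a <= x <= b -> is_derive h x (dh x)) ->
  (forall x, a <= x <= b -> dh x <= 0) -> h b <= h a.
Proof.
  intros Hab Hd Hs. destruct (MVT_gen h a b dh) as (c & Hc & Heq).
  - intros x Hx. rewrite Rmin_left, Rmax_right in Hx by easy. apply Hd. lra.
  - intros x Hx. rewrite Rmin_left, Rmax_right in Hx by easy.
    apply continuity_pt_filterlim. apply continuous_ex_derive. exists (dh x). apply Hd. lra.
  - rewrite Rmin_left, Rmax_right in Hc by easy. specialize (Hs c Hc). nra.
Qed.

(** With the integrating factor, the derivative of exp (- lam s) (w + eta / lam) is exp (- lam s) (g
    - eta) <= 0. This works for both signs of [lam]; the opposite inequality comes from applying it
    to - w. *)
Lemma exp_weight_decreasing lam (w g : R -> R) S0 eta : lam <> 0 ->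
  (forall s, S0 <= s -> is_derive w s (lam * w s + g s)) ->
  (forall s, S0 <= s -> g s <= eta) -> forall s1 s, S0 <= s1 <= s ->
  w s + eta / lam <= exp (lam * (s - s1)) * (w s1 + eta / lam).
Proof.
  intros Hl Hw Hg s1 s Hs.
  assert (H : exp (- lam * s) * (w s + eta / lam) <= exp (- lam * s1) * (w s1 + eta / lam)).
  { apply (decreasing_of_derive (fun s => exp (- lam * s) * (w s + eta / lam))
      (fun s => exp (- lam * s) * (g s - eta))); [lra | |].
    - intros x Hx. assert (Hwx := Hw x ltac:(lra)).
      auto_derive; [exists (lam * w x + g x); exact Hwx|].
      replace (Derive (fun x => w x) x) with (lam * w x + g x)
        by (symmetry; apply is_derive_unique; exact Hwx).
      field. exact Hl.
    - intros x Hx. pose proof (exp_pos (- lam * x)). assert (Hgx := Hg x ltac:(lra)). nra. }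
  apply (Rmult_le_compat_l (exp (lam * s))) in H; [|left; apply exp_pos].
  rewrite <- !Rmult_assoc, <- !exp_plus in H.
  replace (lam * s + - lam * s) with 0 in H by ring. rewrite exp_0, Rmult_1_l in H.
  replace (lam * s + - lam * s1) with (lam * (s - s1)) in H by ring. exact H.
Qed.

Lemma exp_ge_sqr x : 0 <= x -> x ^ 2 / 4 <= exp x.
Proof.
  intros Hx. replace (exp x) with (exp (x / 2) * exp (x / 2))
    by (rewrite <- exp_plus; f_equal; field).
  pose proof (exp_ineq1_le (x / 2)). nra.
Qed.

(* The forcing being bounded, a solution starting below [- eta / lam] would decrease
   exponentially. *)
Lemma unstable_lower lam (w g : R -> R) S0 eta K : 0 < lam -> 0 <= S0 -> 0 <= K ->
  (forall s, S0 <= s -> is_derive w s (lam * w s + g s)) ->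
  (forall s, S0 <= s -> g s <= eta) ->
  (forall s, S0 <= s -> - (K + K * s) <= w s) ->
  forall s, S0 <= s -> - (eta / lam) <= w s.
Proof.
  intros Hl HS HK Hw Hg Hgr s1 Hs1. apply Rnot_lt_le. intros Hlt.
  assert (Hexp := exp_weight_decreasing lam w g S0 eta ltac:(lra) Hw Hg s1).
  set (gam := - (w s1 + eta / lam)). assert (Hgam : 0 < gam) by (unfold gam; lra).
  set (G := gam * lam ^ 2 / 4). assert (HG : 0 < G).
  { unfold G. pose proof (Rmult_lt_0_compat _ _ Hgam (pow_lt lam 2 Hl)). lra. }
  set (K' := K + Rabs (eta / lam)).
  assert (HK' : 0 <= K') by (unfold K'; pose proof (Rabs_pos (eta / lam)); lra).
  (* A waiting time after which the quadratic minorant G u ^ 2 of the exponential exceeds the linear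
     bound K' (1 + s1 + u). *)
  set (u := 1 + K' * (2 + s1) / G).
  assert (HuG : G * u = G + K' * (2 + s1)) by (unfold u; field; lra).
  assert (Hu : 1 <= u).
  { unfold u. assert (0 <= K' * (2 + s1) / G) by (apply Rdiv_le_0_compat; [apply Rmult_le_pos|]; lra). lra. }
  assert (Hs1u : S0 <= s1 <= s1 + u) by lra. specialize (Hexp (s1 + u) Hs1u). specialize (Hgr (s1 + u) ltac:(lra)).
  replace (s1 + u - s1) with u in Hexp by ring.
  pose proof (exp_ge_sqr (lam * u) ltac:(nra)) as He.
  assert (H1 : exp (lam * u) * (w s1 + eta / lam) <= - (G * u * u)).
  { replace (w s1 + eta / lam) with (- gam) by (unfold gam; ring).
    assert (gam * ((lam * u) ^ 2 / 4) <= gam * exp (lam * u)) by (apply Rmult_le_compat_l; lra).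
    replace (G * u * u) with (gam * ((lam * u) ^ 2 / 4)) by (unfold G; field). lra. }
  pose proof (Rle_abs (- (eta / lam))) as H2. rewrite Rabs_Ropp in H2.
  assert (H3 : G * u * u <= K' * (1 + (s1 + u))).
  { unfold K'. pose proof (Rabs_pos (eta / lam)). nra. }
  rewrite HuG in H3. nra.
Qed.

(** The transient is bounded through exp (- x) <= 1 / x: slow decay in s, but only one inverse power
    of [lam], which the weights can absorb. *)
Lemma stable_upper lam (w g : R -> R) S0 eta : lam < 0 ->
  (forall s, S0 <= s -> is_derive w s (lam * w s + g s)) ->
  (forall s, S0 <= s -> g s <= eta) -> 0 <= eta ->
  forall s, S0 < s -> w s <= eta / Rabs lam + Rabs (w S0) / (Rabs lam * (s - S0)).
Proof.
  intros Hl Hw Hg Heta s Hs.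
  assert (Hexp := exp_weight_decreasing lam w g S0 eta ltac:(lra) Hw Hg S0 s ltac:(lra)).
  rewrite Rabs_left by easy.
  replace (eta / - lam) with (- (eta / lam)) by (field; lra).
  set (x := - lam * (s - S0)). assert (Hx : 0 < x) by (unfold x; nra).
  replace (lam * (s - S0)) with (- x) in Hexp by (unfold x; ring).
  assert (He : exp (- x) <= / x).
  { rewrite exp_Ropp. apply Rinv_le_contravar; [easy|]. pose proof (exp_ineq1_le x). lra. }
  assert (H1 : eta / lam <= 0).
  { replace (eta / lam) with (- (eta / - lam)) by (field; lra).
    assert (0 <= eta / - lam) by (apply Rdiv_le_0_compat; lra). lra. }
  pose proof (exp_pos (- x)). pose proof (Rle_abs (w S0)). pose proof (Rabs_pos (w S0)).
  assert (exp (- x) * (w S0 + eta / lam) <= Rabs (w S0) / x).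
  { apply Rle_trans with (exp (- x) * Rabs (w S0)); [nra|].
    unfold Rdiv. rewrite (Rmult_comm (Rabs (w S0))). nra. }
  lra.
Qed.

(** Freeze the forcing at [S0] and subtract the equilibrium - F S0 / lam: the remainder is driven by
    F - F S0, of size [eta]. For lam < 0 it relaxes; for lam > 0 the growth bound already confines
    it to eta / lam from [S0] on. [K] is absent from the conclusion, so it may depend on the
    mode. *)
Lemma scalar_mode lam (a F : R -> R) S0 eta K : lam <> 0 -> 0 <= S0 -> 0 <= K ->
  (forall s, S0 <= s -> is_derive a s (lam * a s + F s)) ->
  (forall s, S0 <= s -> Rabs (F s - F S0) <= eta) ->
  (forall s, S0 <= s -> Rabs (a s) <= K + K * s) ->
  forall s, S0 < s -> Rabs (a s + F S0 / lam) <=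
    eta / Rabs lam + Rabs (a S0 + F S0 / lam) / (Rabs lam * (s - S0)).
Proof.
  intros Hl HS HK Ha HF Hgr s Hs.
  set (c := F S0 / lam). set (g := fun s => F s - F S0).
  set (w := fun s => a s + c).
  assert (Heta : 0 <= eta) by (apply Rle_trans with (1 := Rabs_pos (F S0 - F S0)), HF; lra).
  assert (Hw1 : forall s, S0 <= s -> is_derive w s (lam * w s + g s)).
  { intros x Hx. unfold w. evar_last.
    - apply (is_derive_plus a (fun _ => c)); [now apply Ha | apply is_derive_const].
    - unfold plus, zero; simpl. unfold g, c. field. exact Hl. }
  assert (Hw2 : forall s, S0 <= s -> is_derive (fun s => - w s) s (lam * - w s + - g s)).
  { intros x Hx. evar_last; [apply (is_derive_opp w); now apply Hw1|].
    unfold opp; simpl. ring. }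
  assert (Hg : forall s, S0 <= s -> - eta <= g s <= eta)
    by (intros x Hx; apply Rabs_le_between, HF, Hx).
  assert (Hab : 0 <= Rabs (w S0) / (Rabs lam * (s - S0))).
  { apply Rdiv_le_0_compat; [apply Rabs_pos|]. apply Rmult_lt_0_compat; [now apply Rabs_pos_lt | lra]. }
  change (a s + c) with (w s). change (a S0 + c) with (w S0).
  destruct (Rtotal_order lam 0) as [H|[H|H]]; [|contradiction|].
  - pose proof (stable_upper lam w g S0 eta H Hw1 (fun s Hs => proj2 (Hg s Hs)) Heta s Hs) as H1.
    assert (Hg' : forall s, S0 <= s -> - g s <= eta) by (intros x Hx; specialize (Hg x Hx); lra).
    pose proof (stable_upper lam (fun s => - w s) (fun s => - g s) S0 eta H Hw2 Hg' Heta s Hs) as H2.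
    cbv beta in H2. rewrite Rabs_Ropp in H2. apply Rabs_le. lra.
  - rewrite (Rabs_pos_eq lam) in * by lra.
    set (K' := K + Rabs c). assert (HK' : 0 <= K') by (unfold K'; pose proof (Rabs_pos c); lra).
    assert (Hgr' : forall s, S0 <= s -> Rabs (w s) <= K' + K' * s).
    { intros x Hx. unfold w. eapply Rle_trans; [apply Rabs_triang|]. specialize (Hgr x Hx).
      unfold K'. pose proof (Rabs_pos c). nra. }
    assert (H1 := unstable_lower lam w g S0 eta K' H HS HK' Hw1 (fun s Hs => proj2 (Hg s Hs))).
    assert (H2 := unstable_lower lam (fun s => - w s) (fun s => - g s) S0 eta K' H HS HK' Hw2).
    assert (Hs' : S0 <= s) by lra.
    assert (H1' := H1 ltac:(intros x Hx; specialize (Hgr' x Hx); apply Rabs_le_between in Hgr'; lra) s Hs').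
    assert (H2' := H2 ltac:(intros x Hx; specialize (Hg x Hx); lra)
      ltac:(intros x Hx; specialize (Hgr' x Hx); apply Rabs_le_between in Hgr'; lra) s Hs').
    apply Rabs_le. cbv beta in *. lra.
Qed.

(** * The forcing *)

Lemma is_derive_continuous (f : R -> R) x l : is_derive f x l -> continuous f x.
Proof. intros H. apply continuous_ex_derive. now exists l. Qed.

Lemma Rabs_triang_minus a b : Rabs (a - b) <= Rabs a + Rabs b.
Proof. unfold Rminus. rewrite <- (Rabs_Ropp b). apply Rabs_triang. Qed.

(** The witnessing family is closed under partial differentiation, so the same family witnesses
    smoothness of the derivative. *)
Lemma smooth1_derive f : smooth1 f ->
  (forall y, is_derive f y (Derive f y)) /\ smooth1 (Derive f).
Proof.
  intros (P & HP & Hcl). destruct (Hcl _ HP) as [_ H]. destruct (H O ltac:(lia)) as [H1 H2].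
  split.
  - intros y. apply Derive_correct. exact (H1 (fun _ => y)).
  - exists P. split; [exact H2 | exact Hcl].
Qed.

Lemma smooth1_derive_n f n : smooth1 f -> smooth1 (Derive_n f n).
Proof.
  intros Hf. induction n as [|n IH]; [exact Hf|]. apply (smooth1_derive _ IH).
Qed.

Lemma smooth2_derive f : smooth2 f ->
  (forall s t, is_derive (f s) t (Derive (f s) t)) /\ smooth2 (fun s => Derive (f s)).
Proof.
  intros (P & HP & Hcl). destruct (Hcl _ HP) as [_ H]. destruct (H 1%nat ltac:(lia)) as [H1 H2].
  split.
  - intros s t. apply Derive_correct. exact (H1 (pt2 s t)).
  - exists P. split; [exact H2 | exact Hcl].
Qed.

Lemma smooth2_derive_n f n : smooth2 f -> smooth2 (fun s => Derive_n (f s) n).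
Proof.
  intros Hf. induction n as [|n IH]; [exact Hf|]. apply (smooth2_derive _ IH).
Qed.

(** * Periodization of functions supported inside one period *)

Definition bump (h : R -> R) : Prop :=
  exists r, r < PI /\ forall y, h y <> 0 -> - r < y < r.

Lemma bump_zero h r y : (forall y, h y <> 0 -> - r < y < r) -> (y <= - r \/ r <= y) -> h y = 0.
Proof.
  intros H Hy. destruct (Req_dec (h y) 0) as [E|E]; [exact E|]. specialize (H y E). lra.
Qed.

(** Outside the midpoint radius (r + PI) / 2, h vanishes on a whole neighbourhood of radius (PI - r)
    / 2, hence so does its derivative. The new radius is still below PI. *)
Lemma bump_derive h h' : bump h -> (forall y, is_derive h y (h' y)) -> bump h'.
Proof.
  intros (r & Hr & H) Hd. exists ((r + PI) / 2). split; [lra|]. intros y Hy.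
  apply NNPP. intros Hn. apply Hy.
  rewrite <- (is_derive_unique _ _ _ (Hd y)).
  assert (Hd0 : 0 < (PI - r) / 2) by lra.
  rewrite (Derive_ext_loc h (fun _ => 0)); [apply Derive_const|].
  exists (mkposreal _ Hd0). intros z Hz. apply Rabs_lt_between in Hz.
  unfold minus, plus, opp in Hz; simpl in Hz.
  apply (bump_zero h r z H). lra.
Qed.

Lemma rho_per_eq h y k : - PI <= y - 2 * PI * IZR k < PI -> rho_per h y = h (y - 2 * PI * IZR k).
Proof.
  intros H. unfold rho_per. pose proof PI_RGT_0 as HP.
  replace (Int_part ((y + PI) / (2 * PI))) with k; [reflexivity|].
  apply Int_part_spec.
  assert (E : y + PI = (y + PI) / (2 * PI) * (2 * PI)) by (field; lra).
  split; nra.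
Qed.

Lemma rho_per_shift y : exists k, - PI <= y - 2 * PI * IZR k < PI.
Proof.
  pose proof PI_RGT_0 as HP. destruct (period_shift (2 * PI) (y + PI)) as [k Hk]; [lra|].
  exists (- k)%Z. rewrite opp_IZR. lra.
Qed.

Lemma rho_per_periodic h y k : rho_per h (y + 2 * PI * IZR k) = rho_per h y.
Proof.
  destruct (rho_per_shift y) as [j Hj].
  rewrite (rho_per_eq h y j Hj), (rho_per_eq h _ (j + k)); rewrite plus_IZR.
  - f_equal. ring.
  - lra.
Qed.

Lemma is_derive_rho_per h h' y : bump h -> (forall y, is_derive h y (h' y)) ->
  is_derive (rho_per h) y (rho_per h' y).
Proof.
  intros Hb Hd. destruct (bump_derive h h' Hb Hd) as (r' & Hr' & Hs').
  destruct Hb as (r & Hr & Hs). pose proof PI_RGT_0 as HP.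
  destruct (rho_per_shift y) as [k Hk].
  rewrite (rho_per_eq h' y k Hk).
  destruct (Rle_lt_or_eq_dec (- PI) (y - 2 * PI * IZR k)) as [H|H]; [lra| |].
  - assert (Hdel : 0 < Rmin (y - 2 * PI * IZR k + PI) (PI - (y - 2 * PI * IZR k)))
      by (apply Rmin_glb_lt; lra).
    apply (is_derive_ext_loc (fun z => h (z - 2 * PI * IZR k))).
    + exists (mkposreal _ Hdel). intros z Hz. symmetry. apply rho_per_eq.
      unfold ball in Hz; simpl in Hz. unfold AbsRing_ball, abs, minus, plus, opp in Hz; simpl in Hz.
      apply Rabs_lt_between in Hz.
      pose proof (Rmin_l (y - 2 * PI * IZR k + PI) (PI - (y - 2 * PI * IZR k))).
      pose proof (Rmin_r (y - 2 * PI * IZR k + PI) (PI - (y - 2 * PI * IZR k))). lra.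
    + evar_last.
      * apply (is_derive_comp h (fun z => z - 2 * PI * IZR k)); [apply Hd | auto_derive; [easy | reflexivity]].
      * unfold scal; simpl; unfold mult; simpl. ring.
  (* At the seam the representative jumps by a period, but h vanishes near both ends of [- PI, PI),
     so the periodization is locally zero. *)
  - rewrite (bump_zero h' r' _ Hs') by lra.
    assert (Hdel : 0 < Rmin PI (PI - r)) by (apply Rmin_glb_lt; lra).
    apply (is_derive_ext_loc (fun _ => 0)); [|apply (@is_derive_const R_AbsRing R_NormedModule)].
    exists (mkposreal _ Hdel). intros z Hz.
    unfold ball in Hz; simpl in Hz. unfold AbsRing_ball, abs, minus, plus, opp in Hz; simpl in Hz.
    apply Rabs_lt_between in Hz.
    pose proof (Rmin_l PI (PI - r)). pose proof (Rmin_r PI (PI - r)).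
    destruct (Rle_lt_dec (- PI) (z - 2 * PI * IZR k)) as [H2|H2].
    + rewrite (rho_per_eq h z k) by lra. symmetry. apply (bump_zero h r _ Hs). lra.
    + rewrite (rho_per_eq h z (k - 1)) by (rewrite minus_IZR; lra).
      symmetry. apply (bump_zero h r _ Hs). rewrite minus_IZR. lra.
Qed.

Definition rper (rho : R -> R) (j : nat) : R -> R := rho_per (Derive_n rho j).

Lemma bump_derive_n rho j : smooth1 rho -> bump rho -> bump (Derive_n rho j).
Proof.
  intros Hs Hb. induction j as [|j IH]; [exact Hb|].
  apply (bump_derive _ _ IH). apply (smooth1_derive _ (smooth1_derive_n rho j Hs)).
Qed.

Lemma is_derive_rper rho j y : smooth1 rho -> bump rho ->
  is_derive (rper rho j) y (rper rho (S j) y).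
Proof.
  intros Hs Hb. apply is_derive_rho_per; [now apply bump_derive_n|].
  apply (smooth1_derive _ (smooth1_derive_n rho j Hs)).
Qed.

Lemma rper_bounded rho j : smooth1 rho -> bump rho -> exists M, forall y, Rabs (rper rho j y) <= M.
Proof.
  intros Hs Hb. apply (periodic_bounded (rper rho j) (2 * PI)).
  - apply two_PI_pos.
  - intros y. pose proof (rho_per_periodic (Derive_n rho j) y 1) as H.
    replace (2 * PI * 1) with (2 * PI) in H by ring. exact H.
  - intros y. eapply is_derive_continuous. now apply is_derive_rper.
Qed.

(* [n] derivatives in [t], each bounded for large [s] (the threshold may depend on the order). *)
Fixpoint tame (T : R) (n : nat) (g : R -> R -> R -> R) : Prop :=
  (exists S0 C, forall s t x, S0 < s -> Rabs (g s t x) <= C) /\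
  (forall s, cont2 (g s)) /\
  (forall s t x, g s (t + T) x = g s t x) /\
  match n with
  | O => True
  | S n => exists g', (forall s t x, is_derive (fun t => g s t x) t (g' s t x)) /\ tame T n g'
  end.

Lemma tame_mono T n g : tame T (S n) g -> tame T n g.
Proof.
  revert g. induction n as [|n IH]; intros g (H1 & H2 & H3 & g' & H4 & H5).
  - simpl. auto.
  - simpl. repeat split; auto. exists g'. split; [exact H4|]. now apply IH.
Qed.

Lemma tame_plus T n f g : tame T n f -> tame T n g -> tame T n (fun s t x => f s t x + g s t x).
Proof.
  revert f g. induction n as [|n IH];
    intros f g ((S1 & C1 & F1) & F2 & F3 & F4) ((S2 & C2 & G1) & G2 & G3 & G4).
  all: split; [|split; [auto with cont | split; [intros; now rewrite F3, G3|]]].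
  1, 3: exists (Rmax S1 S2), (C1 + C2); intros s t x Hs;
    pose proof (Rmax_l S1 S2); pose proof (Rmax_r S1 S2);
    eapply Rle_trans; [apply Rabs_triang|]; apply Rplus_le_compat; [apply F1 | apply G1]; lra.
  - exact I.
  - destruct F4 as (f' & F4 & F5), G4 as (g' & G4 & G5).
    exists (fun s t x => f' s t x + g' s t x). split; [|now apply IH].
    intros s t x. apply (is_derive_plus (fun t => f s t x) (fun t => g s t x)); auto.
Qed.

Lemma tame_mult T n f g : tame T n f -> tame T n g -> tame T n (fun s t x => f s t x * g s t x).
Proof.
  revert f g. induction n as [|n IH]; intros f g Hf Hg;
    pose proof Hf as ((S1 & C1 & F1) & F2 & F3 & F4);
    pose proof Hg as ((S2 & C2 & G1) & G2 & G3 & G4).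
  all: split; [|split; [auto with cont | split; [intros; now rewrite F3, G3|]]].
  1, 3: exists (Rmax S1 S2), (C1 * C2); intros s t x Hs;
    pose proof (Rmax_l S1 S2); pose proof (Rmax_r S1 S2); rewrite Rabs_mult;
    apply Rmult_le_compat; try apply Rabs_pos; [apply F1 | apply G1]; lra.
  - exact I.
  - destruct F4 as (f' & F4 & F5), G4 as (g' & G4 & G5).
    exists (fun s t x => f' s t x * g s t x + f s t x * g' s t x). split.
    + intros s t x. apply (is_derive_mult (fun t => f s t x) (fun t => g s t x)); auto.
      intros; apply Rmult_comm.
    + apply tame_plus; apply IH; auto using tame_mono.
Qed.

Lemma tame_cf T n g : 0 < T -> tame T n g -> exists S0 C, forall s m k al, S0 < s ->
  Rabs (omega T m) ^ n * Rabs (cf T (g s) m k al) <= C.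
Proof.
  intros HT. revert g. induction n as [|n IH]; intros g ((S0 & C & F1) & F2 & F3 & F4).
  - exists S0, (2 * PI * T * C). intros s m k al Hs. simpl. rewrite Rmult_1_l.
    apply cf_bound; auto.
  - destruct F4 as (g' & Hd & Hg'). destruct (IH _ Hg') as (S1 & C1 & H1).
    exists S1, C1. intros s m k al Hs. specialize (H1 s m k (al + PI / 2) Hs).
    rewrite (cf_dt T (g s)) in H1; auto.
    + replace (al + PI / 2 - PI / 2) with al in H1 by ring. rewrite Rabs_mult in H1.
      simpl. lra.
    + destruct n; apply Hg'.
Qed.

Lemma cont2_rper_sub rho j q : smooth1 rho -> bump rho -> (forall t, continuous q t) ->
  cont2 (fun t x => rper rho j (q t - x)).
Proof.
  intros Hs Hb Hq. apply cont2_intro. intros p.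
  apply (continuous_comp (fun p : R * R => q (fst p) - snd p) (rper rho j)).
  - apply (continuous_minus (fun p : R * R => q (fst p)) (fun p => snd p)).
    + apply (continuous_comp fst q); [apply continuous_fst | apply Hq].
    + apply continuous_snd.
  - eapply is_derive_continuous. now apply is_derive_rper.
Qed.

(** The increment [c] is allowed because the lifted angle gains a multiple of 2 pi over one period;
    its derivatives are periodic all the same. *)
Lemma derive_periodic (f : R -> R) T c t : (forall t, ex_derive f t) ->
  (forall t, f (t + T) = f t + c) -> Derive f (t + T) = Derive f t.
Proof.
  intros Hd H. transitivity (Derive (fun t => f (t + T)) t).
  - symmetry. apply is_derive_unique. evar_last.
    + apply (is_derive_comp f (fun t => t + T));
        [apply Derive_correct, Hd | auto_derive; [easy | reflexivity]].
    + unfold scal; simpl; unfold mult; simpl. as_real_eq. ring.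
  - rewrite (Derive_ext _ (fun t => f t + c)) by exact H.
    rewrite Derive_plus, Derive_const; [ring | apply Hd | apply ex_derive_const].
Qed.

Lemma derive_n_minus_smooth f g n t : smooth1 f -> smooth1 g ->
  Derive_n (fun t => f t - g t) n t = Derive_n f n t - Derive_n g n t.
Proof.
  intros Hf Hg. revert t. induction n as [|n IH]; intros t; [reflexivity|].
  simpl. rewrite (Derive_ext _ _ t IH). apply Derive_minus.
  - eexists. apply (smooth1_derive _ (smooth1_derive_n f n Hf)).
  - eexists. apply (smooth1_derive _ (smooth1_derive_n g n Hg)).
Qed.

(** The witnessing family consists of the members of the given family with coordinate 0 frozen at
    [s]. *)
Lemma smooth2_slice f s : smooth2 f -> smooth1 (f s).
Proof.
  intros (P & HP & Hcl).
  exists (fun h => exists G, P G /\ forall v, h v = G (fun j => match j with O => s | S j => v j end)).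
  split; [exists (fun v => f (v O) (v 1%nat)); split; [exact HP | reflexivity]|].
  intros h (G & HG & E). destruct (Hcl _ HG) as [Hc Hd]. split.
  - intros v eps He.
    destruct (Hc (fun j => match j with O => s | S j => v j end) eps He) as (d & Hd0 & H).
    exists d. split; [exact Hd0|]. intros y Hy. rewrite !E. apply H.
    intros [|j] Hj; [now rewrite Rminus_diag, Rabs_R0 | apply Hy; lia].
  - intros i Hi. replace i with O by lia. destruct (Hd 1%nat ltac:(lia)) as [H1 H2].
    assert (Hupd : forall v y, h (upd v 0 y) =
      G (upd (fun j => match j with O => s | S j => v j end) 1 y)).
    { intros v y. rewrite E. f_equal. apply functional_extensionality. intros [|[|j]]; reflexivity. }
    split.
    + intros v. apply (ex_derive_ext (fun y => G (upd (fun j => match j with O => s | S j => v j end) 1 y))).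
      * intros y. symmetry. apply Hupd.
      * exact (H1 (fun j => match j with O => s | S j => v j end)).
    + exists (pd 1 G). split; [exact H2|]. intros v. unfold pd. apply Derive_ext. apply Hupd.
Qed.

(** The order starts at [S j], since the lift itself need not be periodic. Boundedness for large s
    comes from closeness to the limit curve, whose derivatives are continuous and periodic. *)
Lemma tame_derive_n T (q : R -> R -> R) (qp : R -> R) kp c :
  0 < T -> smooth2 q -> smooth1 qp ->
  (forall s t, q s (t + T) = q s t + c) -> (forall t, qp (t + T) = qp t + kp) ->
  (forall (n : nat) eps, 0 < eps -> exists S0, forall s, S0 < s -> forall t,
     Rabs (Derive_n (fun t' => q s t' - qp t') n t) < eps) ->
  forall n j, tame T n (fun s t _ => Derive_n (q s) (S j) t).
Proof.
  intros HT Hq Hqp HqT HqpT Hconv.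
  assert (Hex : forall n s t, is_derive (Derive_n (q s) n) t (Derive_n (q s) (S n) t)).
  { intros n s t. apply (proj1 (smooth2_derive _ (smooth2_derive_n q n Hq))). }
  assert (Hex' : forall n t, is_derive (Derive_n qp n) t (Derive_n qp (S n) t)).
  { intros n t. apply (proj1 (smooth1_derive _ (smooth1_derive_n qp n Hqp))). }
  assert (Hper : forall (f : R -> R) d, (forall n t, is_derive (Derive_n f n) t (Derive_n f (S n) t)) ->
     (forall t, f (t + T) = f t + d) -> forall j t, Derive_n f (S j) (t + T) = Derive_n f (S j) t).
  { intros f d Hf HfT. induction j as [|j IH]; intros t.
    - apply (derive_periodic f T d); [|exact HfT]. intros u. eexists. apply (Hf O).
    - apply (derive_periodic (Derive_n f (S j)) T 0).
      + intros u. eexists. apply (Hf (S j)).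
      + intros u. rewrite IH. ring. }
  assert (Hbase : forall j,
    (exists S0 C, forall s (t x : R), S0 < s -> Rabs (Derive_n (q s) (S j) t) <= C) /\
    (forall s, cont2 (fun t _ => Derive_n (q s) (S j) t)) /\
    (forall s t (x : R), Derive_n (q s) (S j) (t + T) = Derive_n (q s) (S j) t)).
  { intros j. split; [|split].
    - destruct (periodic_bounded (Derive_n qp (S j)) T HT) as [M HM].
      + apply (Hper qp kp); auto.
      + intros t. eapply is_derive_continuous. apply Hex'.
      + destruct (Hconv (S j) 1 Rlt_0_1) as [S0 HS]. exists S0, (1 + M). intros s t _ Hs.
        specialize (HS s Hs t). rewrite derive_n_minus_smooth in HS; auto using smooth2_slice.
        replace (Derive_n (q s) (S j) t) with
          ((Derive_n (q s) (S j) t - Derive_n qp (S j) t) + Derive_n qp (S j) t) by ring.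
        eapply Rle_trans; [apply Rabs_triang|]. specialize (HM t). lra.
    - intros s. apply cont2_fst. intros t. eapply is_derive_continuous. apply Hex.
    - intros s t _. apply (Hper (q s) c); auto. }
  induction n as [|n IH]; intros j; destruct (Hbase j) as (B1 & B2 & B3);
    (split; [exact B1 | split; [exact B2 | split; [exact B3|]]]).
  - exact I.
  - exists (fun s t _ => Derive_n (q s) (S (S j)) t). split; [|apply IH].
    intros s t _. apply Hex.
Qed.

(** The chain rule yields [rper rho (S j)] times a derivative of q, so the induction on the order in
    t must cover every [j] at once. *)
Lemma tame_forcing T rho q kq : 0 < T -> smooth1 rho -> bump rho -> smooth2 q ->
  (forall s t, q s (t + T) = q s t + 2 * PI * IZR kq) ->
  (forall n j, tame T n (fun s t _ => Derive_n (q s) (S j) t)) ->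
  forall n j, tame T n (fun s t x => rper rho j (q s t - x)).
Proof.
  intros HT Hs Hb Hq HqT Hder.
  assert (Hbase : forall j,
    (exists S0 C, forall s t x, S0 < s -> Rabs (rper rho j (q s t - x)) <= C) /\
    (forall s, cont2 (fun t x => rper rho j (q s t - x))) /\
    (forall s t x, rper rho j (q s (t + T) - x) = rper rho j (q s t - x))).
  { intros j. split; [|split].
    - destruct (rper_bounded rho j Hs Hb) as [M HM]. exists 0, M. intros; apply HM.
    - intros s. apply cont2_rper_sub; auto. intros t. eapply is_derive_continuous.
      apply (smooth2_derive q Hq).
    - intros s t x. rewrite HqT.
      replace (q s t + 2 * PI * IZR kq - x) with (q s t - x + 2 * PI * IZR kq) by ring.
      apply rho_per_periodic. }
  induction n as [|n IH]; intros j; destruct (Hbase j) as (B1 & B2 & B3);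
    (split; [exact B1 | split; [exact B2 | split; [exact B3|]]]).
  - exact I.
  - exists (fun s t x => rper rho (S j) (q s t - x) * Derive_n (q s) 1 t). split.
    + intros s t x. evar_last.
      * apply (is_derive_comp (rper rho j) (fun t => q s t - x)); [now apply is_derive_rper|].
        apply (is_derive_minus (q s) (fun _ => x)); [apply (smooth2_derive q Hq) | apply is_derive_const].
      * unfold scal, minus, plus, opp, zero; simpl; unfold mult; simpl.
        change (Derive (fun x0 => q s x0) t) with (Derive (q s) t). ring.
    + apply tame_mult; [apply IH | apply Hder].
Qed.

(** * Fourier decay and Cauchy bounds of the forcing *)

Lemma pow_weight_le a N : (1 + a ^ 2) ^ N <= 2 ^ N * (1 + Rabs a ^ (2 * N)).
Proof.
  rewrite <- (pow2_abs a), pow_mult. set (b := Rabs a ^ 2).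
  assert (Hb : 0 <= b) by apply pow2_ge_0.
  assert (H2 : 0 <= 2 ^ N) by (apply pow_le; lra).
  assert (HbN : 0 <= b ^ N) by now apply pow_le.
  destruct (Rle_lt_dec b 1) as [H|H].
  - apply Rle_trans with (2 ^ N); [apply pow_incr; lra | nra].
  - apply Rle_trans with ((2 * b) ^ N); [apply pow_incr; lra|]. rewrite Rpow_mult_distr. nra.
Qed.

(** Expanding weight ^ N leaves four monomials, with exponent 0 or 2 N in each frequency; the
    hypothesis is used for these four pairs only. *)
Lemma decay_weight T (X : R -> Z -> Z -> R -> R) : 0 < T ->
  (forall n p, exists S0 C, forall s m k al, S0 < s ->
     Rabs (omega T m) ^ n * (Rabs (IZR k) ^ p * Rabs (X s m k al)) <= C) ->
  forall N, exists S0 C, 0 <= C /\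
    forall s m k al, S0 < s -> Rabs (X s m k al) <= C / weight m k ^ N.
Proof.
  intros HT H N. set (M := (2 * N)%nat). pose proof PI_RGT_0 as HP.
  set (w := 2 * PI / T). assert (Hw : 0 < w) by (apply Rdiv_lt_0_compat; lra).
  destruct (H O O) as (S1 & C1 & H1), (H M O) as (S2 & C2 & H2),
    (H O M) as (S3 & C3 & H3), (H M M) as (S4 & C4 & H4).
  assert (HwM : 0 < w ^ M) by now apply pow_lt.
  assert (Hom : forall m, Rabs (IZR m) ^ M = / w ^ M * Rabs (omega T m) ^ M).
  { intros m. unfold omega. fold w. rewrite Rabs_mult, (Rabs_pos_eq w), Rpow_mult_distr by lra.
    field. lra. }
  set (C := 2 ^ N * 2 ^ N * (C1 + / w ^ M * C2 + C3 + / w ^ M * C4)).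
  exists (Rmax (Rmax S1 S2) (Rmax S3 S4)), (Rabs C). split; [apply Rabs_pos|].
  intros s m k al Hs.
  pose proof (Rmax_l S1 S2). pose proof (Rmax_r S1 S2).
  pose proof (Rmax_l S3 S4). pose proof (Rmax_r S3 S4).
  pose proof (Rmax_l (Rmax S1 S2) (Rmax S3 S4)). pose proof (Rmax_r (Rmax S1 S2) (Rmax S3 S4)).
  specialize (H1 s m k al ltac:(lra)). specialize (H2 s m k al ltac:(lra)).
  specialize (H3 s m k al ltac:(lra)). specialize (H4 s m k al ltac:(lra)).
  set (x := Rabs (X s m k al)) in *. assert (Hx : 0 <= x) by apply Rabs_pos.
  assert (HW : 0 < weight m k ^ N) by (apply pow_lt; pose proof (weight_ge_1 m k); lra).
  apply (Rmult_le_reg_r (weight m k ^ N)); [exact HW|].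
  replace (Rabs C / weight m k ^ N * weight m k ^ N) with (Rabs C) by (field; lra).
  apply Rle_trans with C; [|apply Rle_abs].
  unfold weight. rewrite Rpow_mult_distr.
  pose proof (pow_weight_le (IZR m) N) as A1. pose proof (pow_weight_le (IZR k) N) as A2.
  fold M in A1, A2. rewrite Hom in A1.
  set (a := Rabs (omega T m) ^ M) in *. set (b := Rabs (IZR k) ^ M) in *.
  assert (P1 : 0 <= (1 + IZR m ^ 2) ^ N) by (apply pow_le; pose proof (pow2_ge_0 (IZR m)); lra).
  assert (P2 : 0 <= (1 + IZR k ^ 2) ^ N) by (apply pow_le; pose proof (pow2_ge_0 (IZR k)); lra).
  apply Rle_trans with (x * ((2 ^ N * (1 + / w ^ M * a)) * (2 ^ N * (1 + b)))).
  { apply Rmult_le_compat_l; [exact Hx|]. now apply Rmult_le_compat. }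
  replace (x * (2 ^ N * (1 + / w ^ M * a) * (2 ^ N * (1 + b)))) with
    (2 ^ N * 2 ^ N * (x + / w ^ M * (a * x) + b * x + / w ^ M * (a * (b * x)))) by ring.
  simpl in H1, H2, H3.
  assert (P3 : 0 < 2 ^ N) by (apply pow_lt; lra).
  assert (P4 : 0 < / w ^ M) by now apply Rinv_0_lt_compat.
  unfold C. apply Rmult_le_compat_l; [apply Rmult_le_pos; lra|].
  assert (/ w ^ M * (a * x) <= / w ^ M * C2) by (apply Rmult_le_compat_l; lra).
  assert (/ w ^ M * (a * (b * x)) <= / w ^ M * C4) by (apply Rmult_le_compat_l; lra).
  lra.
Qed.

(** The variable x enters only through q - x, so each integration by parts in x raises [j] by one,
    up to sign. Hence the generalization over [j]; powers of omega come from tameness. *)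
Lemma forcing_decay T rho q : 0 < T -> smooth1 rho -> bump rho -> smooth2 q ->
  (forall n j, tame T n (fun s t x => rper rho j (q s t - x))) ->
  forall N, exists S0 C, 0 <= C /\ forall s m k al, S0 < s ->
    Rabs (cf T (fun t x => rper rho 0 (q s t - x)) m k al) <= C / weight m k ^ N.
Proof.
  intros HT Hs Hb Hq Ht.
  apply (decay_weight T (fun s => cf T (fun t x => rper rho 0 (q s t - x)))); [exact HT|].
  intros n p. generalize O as j. induction p as [|p IH]; intros j.
  - destruct (tame_cf T n _ HT (Ht n j)) as (S0 & C & H). exists S0, C.
    intros s m k al Hs'. simpl. rewrite Rmult_1_l. now apply H.
  - destruct (IH (S j)) as (S0 & C & H). exists S0, C. intros s m k al Hs'.
    specialize (H s m k (al + PI / 2) Hs').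
    assert (Hc : forall j, cont2 (fun t x => rper rho j (q s t - x))).
    { intros i. apply cont2_rper_sub; auto. intros t. eapply is_derive_continuous.
      apply (smooth2_derive q Hq). }
    assert (E : cf T (fun t x => - rper rho (S j) (q s t - x)) m k (al + PI / 2) =
       IZR k * cf T (fun t x => rper rho j (q s t - x)) m k al).
    { rewrite (cf_dx T (fun t x => rper rho j (q s t - x))); auto with cont.
      - do 2 f_equal. ring.
      - intros t x. evar_last.
        + apply (is_derive_comp (rper rho j) (fun x => q s t - x)); [now apply is_derive_rper|].
          auto_derive; [easy | reflexivity].
        + unfold scal; simpl; unfold mult; simpl. ring.
      - intros t x. replace (q s t - (x + 2 * PI)) with (q s t - x + 2 * PI * IZR (-1)) by (simpl; ring).
        apply rho_per_periodic. }
    rewrite cf_opp in E by apply Hc.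
    apply (f_equal Rabs) in E. rewrite Rabs_Ropp, Rabs_mult in E.
    rewrite E in H. simpl. lra.
Qed.

Lemma lipschitz_of_derive (f f' : R -> R) M x y : (forall z, is_derive f z (f' z)) ->
  (forall z, Rabs (f' z) <= M) -> Rabs (f x - f y) <= M * Rabs (x - y).
Proof.
  intros Hd HM. destruct (MVT_gen f y x f') as (c & _ & E).
  - intros; apply Hd.
  - intros z _. apply continuity_pt_filterlim. eapply is_derive_continuous. apply Hd.
  - rewrite E, Rabs_mult. apply Rmult_le_compat_r; [apply Rabs_pos | apply HM].
Qed.

Lemma forcing_cauchy T rho q qp : 0 < T -> smooth1 rho -> bump rho -> smooth2 q ->
  (forall n j, tame T n (fun s t x => rper rho j (q s t - x))) ->
  (forall eps, 0 < eps -> exists S0, forall s, S0 < s -> forall t : R, Rabs (q s t - qp t) < eps) ->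
  forall N eps, 0 < eps -> exists S0, forall s s' m k al, S0 < s -> S0 < s' ->
    Rabs (cf T (fun t x => rper rho 0 (q s t - x)) m k al -
          cf T (fun t x => rper rho 0 (q s' t - x)) m k al) <= eps / weight m k ^ N.
Proof.
  intros HT Hs Hb Hq Ht Hconv N eps He. pose proof PI_RGT_0 as HP.
  destruct (forcing_decay T rho q HT Hs Hb Hq Ht (2 * N)%nat) as (S1 & C & HC & H1).
  destruct (rper_bounded rho 1 Hs Hb) as [M HM].
  assert (HM0 : 0 <= M) by (apply Rle_trans with (1 := Rabs_pos (rper rho 1 0)), HM).
  (* Chosen so that the product of the uniform bound and the decay bound is (eps / W) ^ 2 (D - 1) /
     D. The + 1 makes D positive and the comparison strict. *)
  set (D := 2 * PI * T * (M * 2) * (2 * C) + 1).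
    assert (HD : 0 < D).
  { unfold D. assert (0 <= 2 * PI * T * (M * 2) * (2 * C))
      by (generalize PI HP; intros P HP'; repeat apply Rmult_le_pos; lra).
    apply Rplus_le_lt_0_compat; lra. }
  destruct (Hconv (eps ^ 2 / D)) as [S2 H2]; [apply Rdiv_lt_0_compat; [now apply pow_lt | exact HD]|].
  exists (Rmax S1 S2). intros s s' m k al Hss Hss'.
  pose proof (Rmax_l S1 S2). pose proof (Rmax_r S1 S2).
  assert (Hc : forall s, cont2 (fun t x => rper rho 0 (q s t - x))).
  { intros u. apply cont2_rper_sub; auto. intros t. eapply is_derive_continuous.
    apply (smooth2_derive q Hq). }
  assert (A1 : Rabs (cf T (fun t x => rper rho 0 (q s t - x)) m k al -
          cf T (fun t x => rper rho 0 (q s' t - x)) m k al)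
     <= 2 * PI * T * (M * (2 * (eps ^ 2 / D)))).
  { rewrite <- cf_minus by auto. apply cf_bound; auto with cont.
    intros t x. eapply Rle_trans; [apply (lipschitz_of_derive _ (rper rho 1) M);
      [intros; now apply is_derive_rper | exact HM]|].
    apply Rmult_le_compat_l; [exact HM0|].
    replace (q s t - x - (q s' t - x)) with ((q s t - qp t) + - (q s' t - qp t)) by ring.
    eapply Rle_trans; [apply Rabs_triang|]. rewrite Rabs_Ropp.
    assert (B1 := H2 s ltac:(lra) t). assert (B2 := H2 s' ltac:(lra) t). lra. }
  assert (A2 : Rabs (cf T (fun t x => rper rho 0 (q s t - x)) m k al -
          cf T (fun t x => rper rho 0 (q s' t - x)) m k al) <= 2 * C / weight m k ^ (2 * N)).
  { assert (B1 := H1 s m k al ltac:(lra)). assert (B2 := H1 s' m k al ltac:(lra)).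
    eapply Rle_trans; [apply Rabs_triang_minus|]. unfold Rdiv in *. lra. }
  set (x := Rabs _) in *. assert (Hx : 0 <= x) by apply Rabs_pos.
  assert (HW : 0 < weight m k ^ N) by (apply pow_lt; pose proof (weight_ge_1 m k); lra).
  set (W := weight m k ^ N) in *.
  replace (weight m k ^ (2 * N)) with (W * W) in A2
    by (unfold W; rewrite <- pow_add; f_equal; lia).
  assert (HeW : 0 < eps / W) by now apply Rdiv_lt_0_compat.
  apply Rnot_lt_le. intros Hlt.
  (* interpolation: the square of the difference is at most the product of both bounds *)
  assert (A3 : x * x <= 2 * PI * T * (M * (2 * (eps ^ 2 / D))) * (2 * C / (W * W)))
    by (now apply Rmult_le_compat).
  assert (A4 : 2 * PI * T * (M * (2 * (eps ^ 2 / D))) * (2 * C / (W * W)) =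
     (eps / W) * (eps / W) * ((D - 1) / D)) by (unfold D; field; unfold D in HD; lra).
  assert (A5 : (D - 1) / D < 1) by (apply (Rmult_lt_reg_r D); [exact HD|]; field_simplify; lra).
  rewrite A4 in A3. set (e := eps / W) in *.
  assert (A6 : e * e < x * x) by (apply Rmult_le_0_lt_compat; lra).
  assert (A7 : e * e * ((D - 1) / D) < e * e * 1) by (apply Rmult_lt_compat_l; [nra | exact A5]).
  lra.
Qed.

(** * The mode equations *)

(* The Fourier transform of the field equations; a quarter-period shift of the phase plays the
   role of the imaginary unit. *)
Definition mode_system (T : R) (c : nat -> R -> Z -> Z -> R -> R) (F : R -> Z -> Z -> R -> R) :=
  forall s m k al,
  is_derive (fun s => c 0%nat s m k al) s
    (omega T m * c 1%nat s m k (al - PI / 2) - IZR k * c 2%nat s m k (al - PI / 2)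
     + c 0%nat s m k al + F s m k al) /\
  is_derive (fun s => c 1%nat s m k al) s
    (- (omega T m * c 0%nat s m k (al - PI / 2)) + IZR k * c 3%nat s m k (al - PI / 2)
     + c 1%nat s m k al) /\
  is_derive (fun s => c 2%nat s m k al) s
    (- (omega T m * c 3%nat s m k (al - PI / 2)) + IZR k * c 0%nat s m k (al - PI / 2)
     - c 2%nat s m k al) /\
  is_derive (fun s => c 3%nat s m k al) s
    (omega T m * c 2%nat s m k (al - PI / 2) - IZR k * c 1%nat s m k (al - PI / 2)
     - c 3%nat s m k al).

(** Reading the shift by PI / 2 as i, this is A X + C Y with X = c0 + e i c1 and Y = i c2 + e c3.
    For either sign [e] the pair (X, Y) evolves by the symmetric matrix [[1 - e omega, k],
    [k, - 1 - e omega]], so an eigenvector (A, C) gives a scalar equation. *)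
Definition mode (c : nat -> R -> Z -> Z -> R -> R) e A C m k al (s : R) : R :=
  A * c 0%nat s m k al + e * A * c 1%nat s m k (al + PI / 2)
  + C * c 2%nat s m k (al + PI / 2) + e * C * c 3%nat s m k al.

Lemma mode_derive T c F e A C lam m k al s :
  mode_system T c F ->
  (forall i s m k al, (i < 4)%nat -> c i s m k (al - PI / 2) = - c i s m k (al + PI / 2)) ->
  e = 1 \/ e = -1 ->
  A * (1 - e * omega T m) + C * IZR k = lam * A ->
  A * IZR k + C * (- 1 - e * omega T m) = lam * C ->
  is_derive (mode c e A C m k al) s (lam * mode c e A C m k al s + A * F s m k al).
Proof.
  intros Hsys Hopp He E1 E2.
  destruct (Hsys s m k al) as (D0 & _ & _ & D3).
  destruct (Hsys s m k (al + PI / 2)) as (_ & D1 & D2 & _).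
  replace (al + PI / 2 - PI / 2) with al in D1, D2 by ring.
  rewrite !Hopp in D0, D3 by lia. unfold mode.
  set (w := omega T m) in *. set (kk := IZR k) in *.
  evar_last.
  - apply (is_derive_plus (fun s => A * c 0%nat s m k al + e * A * c 1%nat s m k (al + PI / 2)
      + C * c 2%nat s m k (al + PI / 2)) (fun s => e * C * c 3%nat s m k al)).
    + apply (is_derive_plus (fun s => A * c 0%nat s m k al + e * A * c 1%nat s m k (al + PI / 2))
        (fun s => C * c 2%nat s m k (al + PI / 2))).
      * apply (is_derive_plus (fun s => A * c 0%nat s m k al)
          (fun s => e * A * c 1%nat s m k (al + PI / 2))).
        -- apply (is_derive_scal (fun s => c 0%nat s m k al)), D0.
        -- apply (is_derive_scal (fun s => c 1%nat s m k (al + PI / 2))), D1.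
      * apply (is_derive_scal (fun s => c 2%nat s m k (al + PI / 2))), D2.
    + apply (is_derive_scal (fun s => c 3%nat s m k al)), D3.
  - unfold plus, mult; simpl.
    generalize (c 0%nat s m k al) (c 1%nat s m k (al + PI / 2))
      (c 2%nat s m k (al + PI / 2)) (c 3%nat s m k al) (F s m k al).
    intros p0 p1 p2 p3 f.
    replace (lam * (A * p0 + e * A * p1 + C * p2 + e * C * p3) + A * f) with
      ((lam * A) * p0 + e * (lam * A) * p1 + (lam * C) * p2 + e * (lam * C) * p3 + A * f) by ring.
    rewrite <- E1, <- E2. destruct He; subst e; ring.
Qed.

(** Both times are compared with the equilibrium of the forcing frozen at one [S0] common to all
    modes. The losses in [weight] are one power from the eigenvector coefficients and three from
    every division by [lam]. *)
Lemma mode_cauchy T c F kap : 0 < kap ->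
  mode_system T c F ->
  (forall i s m k al, (i < 4)%nat -> c i s m k (al - PI / 2) = - c i s m k (al + PI / 2)) ->
  (forall m k al, exists K, 0 <= K /\ forall i s, (i < 4)%nat -> 0 <= s ->
     Rabs (c i s m k al) <= K + K * s) ->
  (forall s N, exists C, 0 <= C /\ forall i m k al, (i < 4)%nat ->
     Rabs (c i s m k al) <= C / weight m k ^ N) ->
  (forall N, exists S0 C, 0 <= C /\ forall s m k al, S0 < s ->
     Rabs (F s m k al) <= C / weight m k ^ N) ->
  (forall N eps, 0 < eps -> exists S0, forall s s' m k al, S0 < s -> S0 < s' ->
     Rabs (F s m k al - F s' m k al) <= eps / weight m k ^ N) ->
  forall N eps, 0 < eps -> exists S0, forall s s' m k al e A C lam, S0 < s -> S0 < s' ->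
    e = 1 \/ e = -1 ->
    A * (1 - e * omega T m) + C * IZR k = lam * A ->
    A * IZR k + C * (- 1 - e * omega T m) = lam * C ->
    kap / weight m k ^ 3 <= Rabs lam -> Rabs A <= 2 * weight m k -> Rabs C <= 2 * weight m k ->
    Rabs (mode c e A C m k al s - mode c e A C m k al s') <= eps / weight m k ^ N.
Proof.
  intros Hkap Hsys Hopp Hgrow Hinit HFd HFc N eps Heps.
  set (del := kap * eps / 8). assert (Hdel : 0 < del) by (unfold del; nra).
  (* One power for the coefficient [A], three for one division by [lam]; the 8 in [del] leaves a
     contribution of eps / 4. *)
  destruct (HFc (N + 4)%nat del Hdel) as (S1 & HF1).
  (* Three further powers: the equilibrium A F / lam is divided by [lam] again in the transient
     term. *)
  destruct (HFd (N + 7)%nat) as (S2 & CF & HCF & HF2).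
  set (S0 := Rmax 0 (Rmax S1 S2) + 1).
  assert (HS0 : 0 <= S0 /\ S1 < S0 /\ S2 < S0).
  { unfold S0. pose proof (Rmax_l 0 (Rmax S1 S2)). pose proof (Rmax_r 0 (Rmax S1 S2)).
    pose proof (Rmax_l S1 S2). pose proof (Rmax_r S1 S2). lra. }
  (* The constant [CI] depends on the time, so [S0] had to be fixed first; it does not depend on the
     mode. *)
  destruct (Hinit S0 (N + 4)%nat) as (CI & HCI & HI).
  set (B := 8 * CI + 2 * CF / kap).
  assert (HB : 0 <= B).
  { unfold B. assert (0 <= 2 * CF / kap) by (apply Rdiv_le_0_compat; lra). lra. }
  (* The transient is at most B / (kap (s - S0)) / weight ^ N, and this delay brings it below eps /
     4 / weight ^ N. *)
  exists (S0 + (4 * B / (kap * eps) + 1)).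
  enough (Hone : forall s m k al e A C lam, S0 + (4 * B / (kap * eps) + 1) < s ->
    e = 1 \/ e = -1 ->
    A * (1 - e * omega T m) + C * IZR k = lam * A ->
    A * IZR k + C * (- 1 - e * omega T m) = lam * C ->
    kap / weight m k ^ 3 <= Rabs lam -> Rabs A <= 2 * weight m k -> Rabs C <= 2 * weight m k ->
    Rabs (mode c e A C m k al s + A * F S0 m k al / lam) <= eps / 2 / weight m k ^ N).
  { intros s s' m k al e A C lam Hs Hs' He E1 E2 Hl HA HC.
    pose proof (Hone s m k al e A C lam Hs He E1 E2 Hl HA HC) as X1.
    pose proof (Hone s' m k al e A C lam Hs' He E1 E2 Hl HA HC) as X2.
    replace (mode c e A C m k al s - mode c e A C m k al s') with
      ((mode c e A C m k al s + A * F S0 m k al / lam) -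
       (mode c e A C m k al s' + A * F S0 m k al / lam)) by ring.
    eapply Rle_trans; [apply Rabs_triang_minus|].
    replace (eps / weight m k ^ N) with (eps / 2 / weight m k ^ N + eps / 2 / weight m k ^ N); [lra|].
    field. apply pow_nonzero. pose proof (weight_ge_1 m k). lra. }
  intros s m k al e A C lam Hs He E1 E2 Hl HA HC.
  assert (HeA : Rabs e = 1).
  { destruct He; subst e; [apply Rabs_R1|]. rewrite Rabs_left; lra. }
  pose proof (weight_ge_1 m k) as HW. set (W := weight m k) in *.
  assert (HW3 : 0 < W ^ 3) by (apply pow_lt; lra).
  assert (HWN : 0 < W ^ N) by (apply pow_lt; lra).
  assert (HkW : 0 < kap / W ^ 3) by now apply Rdiv_lt_0_compat.
  assert (Hl0 : lam <> 0) by (intros E; rewrite E, Rabs_R0 in Hl; lra).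
  assert (Hinvl : / Rabs lam <= W ^ 3 / kap).
  { replace (W ^ 3 / kap) with (/ (kap / W ^ 3)) by (field; lra).
    apply Rinv_le_contravar; assumption. }
  assert (Hinv0 : 0 < / Rabs lam) by (apply Rinv_0_lt_compat; lra).
  set (a := mode c e A C m k al).
  assert (Hterm : forall b1 b2 b3 b4 M, Rabs b1 <= M -> Rabs b2 <= M -> Rabs b3 <= M ->
    Rabs b4 <= M -> Rabs (A * b1 + e * A * b2 + C * b3 + e * C * b4) <= 8 * W * M).
  { intros b1 b2 b3 b4 M Q1 Q2 Q3 Q4.
    assert (R4 : forall x y z w, Rabs (x + y + z + w) <= Rabs x + Rabs y + Rabs z + Rabs w).
    { intros x y z w. pose proof (Rabs_triang (x + y + z) w).
      pose proof (Rabs_triang (x + y) z). pose proof (Rabs_triang x y). lra. }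
    eapply Rle_trans; [apply R4|]. rewrite !Rabs_mult, HeA, !Rmult_1_l.
    pose proof (Rmult_le_compat _ _ _ _ (Rabs_pos A) (Rabs_pos b1) HA Q1).
    pose proof (Rmult_le_compat _ _ _ _ (Rabs_pos A) (Rabs_pos b2) HA Q2).
    pose proof (Rmult_le_compat _ _ _ _ (Rabs_pos C) (Rabs_pos b3) HC Q3).
    pose proof (Rmult_le_compat _ _ _ _ (Rabs_pos C) (Rabs_pos b4) HC Q4). lra. }
  assert (Ha0 : Rabs (a S0) <= 8 * CI / W ^ (N + 3)).
  { replace (8 * CI / W ^ (N + 3)) with (8 * W * (CI / W ^ (N + 4)))
      by (rewrite !pow_add; field; lra).
    apply Hterm; apply HI; lia. }
  assert (HAF : Rabs (A * F S0 m k al / lam) <= 2 * CF / kap / W ^ (N + 3)).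
  { unfold Rdiv at 1. rewrite !Rabs_mult, Rabs_inv.
    assert (HFS := HF2 S0 m k al ltac:(lra)). fold W in HFS.
    replace (2 * CF / kap / W ^ (N + 3)) with (2 * W * (CF / W ^ (N + 7)) * (W ^ 3 / kap))
      by (rewrite !pow_add; field; lra).
    apply Rmult_le_compat; [apply Rmult_le_pos; apply Rabs_pos | lra | | exact Hinvl].
    apply Rmult_le_compat; auto using Rabs_pos. }
  assert (Hode : forall s, S0 <= s -> is_derive a s (lam * a s + A * F s m k al))
    by (intros; apply mode_derive with T; assumption).
  assert (HFeta : forall s, S0 <= s ->
    Rabs (A * F s m k al - A * F S0 m k al) <= 2 * W * (del / W ^ (N + 4))).
  { intros u Hu. rewrite <- Rmult_minus_distr_l, Rabs_mult.
    apply Rmult_le_compat; auto using Rabs_pos. apply HF1; lra. }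
  destruct (Hgrow m k al) as (K1 & HK1 & HG1).
  destruct (Hgrow m k (al + PI / 2)) as (K2 & HK2 & HG2).
  set (K := 8 * W * (K1 + K2)). assert (HK : 0 <= K) by (unfold K; apply Rmult_le_pos; lra).
  assert (Hga : forall s, S0 <= s -> Rabs (a s) <= K + K * s).
  { intros u Hu. replace (K + K * u) with (8 * W * ((K1 + K2) * (1 + u))) by (unfold K; ring).
    apply Hterm; [apply Rle_trans with (K1 + K1 * u) | apply Rle_trans with (K2 + K2 * u) |
      apply Rle_trans with (K2 + K2 * u) | apply Rle_trans with (K1 + K1 * u)];
      try (apply HG1); try (apply HG2); try lia; try lra; nra. }
  assert (Hx0 : 0 <= 4 * B / (kap * eps)) by (apply Rdiv_le_0_compat; nra).
  assert (Hmain := scalar_mode lam a (fun s => A * F s m k al) S0 _ K Hl0 (proj1 HS0) HK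
    Hode HFeta Hga s ltac:(lra)).
  cbv beta in Hmain. eapply Rle_trans; [exact Hmain|].
  set (d := s - S0) in *. assert (Hd : 4 * B / (kap * eps) < d) by (unfold d; lra).
  assert (Hd0 : 0 < d) by lra.
  assert (Hb : Rabs (a S0 + A * F S0 m k al / lam) <= B / W ^ (N + 3)).
  { eapply Rle_trans; [apply Rabs_triang|].
    replace (B / W ^ (N + 3)) with (8 * CI / W ^ (N + 3) + 2 * CF / kap / W ^ (N + 3))
      by (unfold B; field; split; first [lra | apply pow_nonzero; lra]). lra. }
  assert (Y1 : 2 * W * (del / W ^ (N + 4)) / Rabs lam <= eps / 4 / W ^ N).
  { replace (eps / 4 / W ^ N) with (2 * W * (del / W ^ (N + 4)) * (W ^ 3 / kap))
      by (unfold del; rewrite !pow_add; field; lra).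
    apply Rmult_le_compat_l; [|exact Hinvl].
    apply Rmult_le_pos; [lra|]. apply Rdiv_le_0_compat; [lra | apply pow_lt; lra]. }
  assert (Y2 : Rabs (a S0 + A * F S0 m k al / lam) / (Rabs lam * d) <= eps / 4 / W ^ N).
  { apply Rle_trans with (B / W ^ (N + 3) * (W ^ 3 / kap * / d)).
    - unfold Rdiv at 1. rewrite Rinv_mult. apply Rmult_le_compat; auto using Rabs_pos.
      + apply Rmult_le_pos; [lra|]. left. now apply Rinv_0_lt_compat.
      + apply Rmult_le_compat_r; [left; now apply Rinv_0_lt_compat | exact Hinvl].
    - replace (B / W ^ (N + 3) * (W ^ 3 / kap * / d)) with (B / (kap * d) / W ^ N)
        by (rewrite !pow_add; field; lra).
      apply Rmult_le_compat_r; [left; now apply Rinv_0_lt_compat|].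
      assert (HB4 : 4 * B = 4 * B / (kap * eps) * (kap * eps)) by (field; lra).
      assert (Hke : 0 < kap * eps) by now apply Rmult_lt_0_compat.
      apply (Rmult_le_reg_r (kap * d)); [now apply Rmult_lt_0_compat|].
      replace (B / (kap * d) * (kap * d)) with B by (field; lra). nra. }
  replace (eps / 2 / W ^ N) with (eps / 4 / W ^ N + eps / 4 / W ^ N) by (field; lra). lra.
Qed.

(* [(E + 1, k)] and [(- k, E + 1)] are the orthogonal eigenvectors of [[1, k], [k, -1]] for the
   eigenvalues [E] and [- E], where [E = sqrt (1 + k^2)]. *)
Lemma eigen_recover E k X Y b1 b2 : 1 <= E -> Rabs k <= E -> E * E = 1 + k ^ 2 ->
  Rabs ((E + 1) * X + k * Y) <= b1 -> Rabs (- k * X + (E + 1) * Y) <= b2 ->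
  Rabs X <= b1 + b2 /\ Rabs Y <= b1 + b2.
Proof.
  intros HE Hk HE2 H1 H2.
  set (u := (E + 1) * X + k * Y) in *. set (v := - k * X + (E + 1) * Y) in *.
  assert (HD : 0 < 2 * E * (E + 1)) by nra.
  assert (EX : X * (2 * E * (E + 1)) = (E + 1) * u - k * v).
  { unfold u, v. replace (2 * E * (E + 1)) with ((E + 1) ^ 2 + k ^ 2) by nra. ring. }
  assert (EY : Y * (2 * E * (E + 1)) = k * u + (E + 1) * v).
  { unfold u, v. replace (2 * E * (E + 1)) with ((E + 1) ^ 2 + k ^ 2) by nra. ring. }
  assert (Hb1 : 0 <= b1) by (apply Rle_trans with (1 := Rabs_pos u); exact H1).
  assert (Hb2 : 0 <= b2) by (apply Rle_trans with (1 := Rabs_pos v); exact H2).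
  assert (Hk0 := Rabs_pos k).
  split; apply (Rmult_le_reg_r (2 * E * (E + 1))); try exact HD;
    rewrite <- (Rabs_pos_eq (2 * E * (E + 1))) at 1 by lra; rewrite <- Rabs_mult.
  - rewrite EX. eapply Rle_trans; [apply Rabs_triang_minus|]. rewrite !Rabs_mult.
    rewrite (Rabs_pos_eq (E + 1)) by lra.
    assert ((E + 1) * Rabs u <= (E + 1) * b1) by (apply Rmult_le_compat_l; lra).
    assert (Rabs k * Rabs v <= E * b2) by (apply Rmult_le_compat; auto using Rabs_pos). nra.
  - rewrite EY. eapply Rle_trans; [apply Rabs_triang|]. rewrite !Rabs_mult.
    rewrite (Rabs_pos_eq (E + 1)) by lra.
    assert ((E + 1) * Rabs v <= (E + 1) * b2) by (apply Rmult_le_compat_l; lra).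
    assert (Rabs k * Rabs u <= E * b1) by (apply Rmult_le_compat; auto using Rabs_pos). nra.
Qed.

(** The eigenvectors do not depend on omega, and the eigenvalues are - e omega + E and - e omega -
    E. Inverting the eigenbasis gives X and Y for both signs of [e]; half sums and half differences
    then isolate the four components. *)
Lemma coefficients_cauchy T c F kap : 0 < kap ->
  (forall m k e d, e ^ 2 = 1 -> d ^ 2 = 1 -> kap / weight m k ^ 3 <= Rabs (e * omega T m + d * disp k)) ->
  mode_system T c F ->
  (forall i s m k al, (i < 4)%nat -> c i s m k (al - PI / 2) = - c i s m k (al + PI / 2)) ->
  (forall m k al, exists K, 0 <= K /\ forall i s, (i < 4)%nat -> 0 <= s ->
     Rabs (c i s m k al) <= K + K * s) ->
  (forall s N, exists C, 0 <= C /\ forall i m k al, (i < 4)%nat ->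
     Rabs (c i s m k al) <= C / weight m k ^ N) ->
  (forall N, exists S0 C, 0 <= C /\ forall s m k al, S0 < s ->
     Rabs (F s m k al) <= C / weight m k ^ N) ->
  (forall N eps, 0 < eps -> exists S0, forall s s' m k al, S0 < s -> S0 < s' ->
     Rabs (F s m k al - F s' m k al) <= eps / weight m k ^ N) ->
  forall N eps, 0 < eps -> exists S0, forall i s s' m k al, (i < 4)%nat -> S0 < s -> S0 < s' ->
    Rabs (c i s m k al - c i s' m k al) <= eps / weight m k ^ N.
Proof.
  intros Hkap Hdiv Hsys Hopp Hgrow Hinit HFd HFc N eps Heps.
  destruct (mode_cauchy T c F kap Hkap Hsys Hopp Hgrow Hinit HFd HFc N (eps / 2))
    as (S0 & H); [lra|].
  exists S0. intros i s s' m k al Hi Hs Hs'.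
  set (W := weight m k) in *. set (b := eps / 2 / W ^ N) in *.
  assert (Hb2 : eps / W ^ N = b + b).
  { unfold b. field. apply pow_nonzero. pose proof (weight_ge_1 m k). fold W in H0. lra. }
  pose proof (disp_ge_1 k) as HE1. pose proof (disp_ge_k k) as HEk. pose proof (disp_sqr k) as HEs.
  pose proof (disp_le k) as HEl. pose proof (weight_ge_r m k) as HWr. fold W in HWr.
  set (E := disp k) in *.
  set (D := fun i al => c i s m k al - c i s' m k al).
  assert (HXY : forall e al, e = 1 \/ e = -1 ->
    Rabs (D 0%nat al + e * D 1%nat (al + PI / 2)) <= b + b /\
    Rabs (D 2%nat (al + PI / 2) + e * D 3%nat al) <= b + b).
  { intros e be He.
    assert (He2 : (- e) ^ 2 = 1) by (destruct He; subst e; ring).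
    apply (eigen_recover E (IZR k)); auto.
    - replace ((E + 1) * (D 0%nat be + e * D 1%nat (be + PI / 2))
         + IZR k * (D 2%nat (be + PI / 2) + e * D 3%nat be))
        with (mode c e (E + 1) (IZR k) m k be s - mode c e (E + 1) (IZR k) m k be s')
        by (unfold mode, D; ring).
      apply (H s s' m k be e (E + 1) (IZR k) (- e * omega T m + 1 * E)); auto.
      + replace (IZR k * IZR k) with (E * E - 1) by (rewrite HEs; ring). ring.
      + ring.
      + apply Hdiv; [exact He2 | ring].
      + fold W. rewrite Rabs_pos_eq; lra.
      + fold W. lra.
    - replace (- IZR k * (D 0%nat be + e * D 1%nat (be + PI / 2))
         + (E + 1) * (D 2%nat (be + PI / 2) + e * D 3%nat be))
        with (mode c e (- IZR k) (E + 1) m k be s - mode c e (- IZR k) (E + 1) m k be s')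
        by (unfold mode, D; ring).
      apply (H s s' m k be e (- IZR k) (E + 1) (- e * omega T m + -1 * E)); auto.
      + ring.
      + replace (- IZR k * IZR k) with (- (E * E - 1)) by (rewrite HEs; ring). ring.
      + apply Hdiv; [exact He2 | ring].
      + fold W. rewrite Rabs_Ropp. lra.
      + fold W. rewrite Rabs_pos_eq; lra. }
  rewrite Hb2.
  assert (Hhalf : forall x y, Rabs (x + 1 * y) <= b + b -> Rabs (x + -1 * y) <= b + b ->
    Rabs x <= b + b /\ Rabs y <= b + b).
  { intros x y A1 A2. apply Rabs_le_between in A1. apply Rabs_le_between in A2.
    split; apply Rabs_le; lra. }
  assert (H01 : forall al, Rabs (D 0%nat al) <= b + b /\ Rabs (D 1%nat (al + PI / 2)) <= b + b)
    by (intros be; apply Hhalf; apply HXY; auto).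
  assert (H23 : forall al, Rabs (D 2%nat (al + PI / 2)) <= b + b /\ Rabs (D 3%nat al) <= b + b)
    by (intros be; apply Hhalf; apply HXY; auto).
  destruct i as [|[|[|[|i]]]]; [| | | |lia].
  - apply H01.
  - replace al with (al - PI / 2 + PI / 2) by ring. apply H01.
  - replace al with (al - PI / 2 + PI / 2) by ring. apply H23.
  - apply H23.
Qed.

(** * Convergence in all derivatives *)

Lemma smooth3_cont3 f : smooth3 f -> cont3 f.
Proof.
  intros (P & HP & Hcl) s t x eps He. destruct (Hcl _ HP) as [Hc _].
  destruct (Hc (pt3 s t x) eps He) as (d & Hd & H). exists d. split; [exact Hd|].
  intros s' t' x' H1 H2 H3. apply (H (pt3 s' t' x')). intros [|[|j]] _; assumption.
Qed.

Lemma smooth2_cont2 f : smooth2 f -> cont2 f.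
Proof.
  intros (P & HP & Hcl) t x eps He. destruct (Hcl _ HP) as [Hc _].
  destruct (Hc (pt2 t x) eps He) as (d & Hd & H). exists d. split; [exact Hd|].
  intros t' x' H1 H2. apply (H (pt2 t' x')). intros [|j] _; assumption.
Qed.

Lemma smooth2_derive1 f : smooth2 f -> smooth2 (fun s t => Derive (fun s => f s t) s).
Proof.
  intros (P & HP & Hcl). destruct (Hcl _ HP) as [_ H]. destruct (H O ltac:(lia)) as [_ H2].
  exists P. split; [exact H2 | exact Hcl].
Qed.

Definition ds3 (f : R -> R -> R -> R) s t x := Derive (fun s => f s t x) s.
Definition dt3 (f : R -> R -> R -> R) s t x := Derive (fun t => f s t x) t.
Definition dx3 (f : R -> R -> R -> R) s t x := Derive (fun x => f s t x) x.

Lemma smooth3_ds f : smooth3 f ->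
  (forall s t x, is_derive (fun s => f s t x) s (ds3 f s t x)) /\ smooth3 (ds3 f).
Proof.
  intros (P & HP & Hcl). destruct (Hcl _ HP) as [_ H]. destruct (H O ltac:(lia)) as [H1 H2].
  split; [|exists P; split; [exact H2 | exact Hcl]].
  intros s t x. apply Derive_correct. exact (H1 (pt3 s t x)).
Qed.

Lemma smooth3_dt f : smooth3 f ->
  (forall s t x, is_derive (fun t => f s t x) t (dt3 f s t x)) /\ smooth3 (dt3 f).
Proof.
  intros (P & HP & Hcl). destruct (Hcl _ HP) as [_ H]. destruct (H 1%nat ltac:(lia)) as [H1 H2].
  split; [|exists P; split; [exact H2 | exact Hcl]].
  intros s t x. apply Derive_correct. exact (H1 (pt3 s t x)).
Qed.

Lemma smooth3_dx f : smooth3 f ->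
  (forall s t x, is_derive (fun x => f s t x) x (dx3 f s t x)) /\ smooth3 (dx3 f).
Proof.
  intros (P & HP & Hcl). destruct (Hcl _ HP) as [_ H]. destruct (H 2%nat ltac:(lia)) as [H1 H2].
  split; [|exists P; split; [exact H2 | exact Hcl]].
  intros s t x. apply Derive_correct. exact (H1 (pt3 s t x)).
Qed.

Definition smooth_torus (T : R) (f : R -> R -> R -> R) : Prop :=
  smooth3 f /\ (forall s t x, f s (t + T) x = f s t x) /\
  (forall s t x, f s t (x + 2 * PI) = f s t x).

Lemma smooth_torus_dt T f : smooth_torus T f -> smooth_torus T (dt3 f).
Proof.
  intros (H1 & H2 & H3). destruct (smooth3_dt f H1) as [Hd Hs]. split; [exact Hs|]. split.
  - intros s t x. apply (derive_periodic (fun t => f s t x) T 0).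
    + intros u. eexists. apply Hd.
    + intros u. rewrite H2. ring.
  - intros s t x. apply Derive_ext. intros; apply H3.
Qed.

Lemma smooth_torus_dx T f : smooth_torus T f -> smooth_torus T (dx3 f).
Proof.
  intros (H1 & H2 & H3). destruct (smooth3_dx f H1) as [Hd Hs]. split; [exact Hs|]. split.
  - intros s t x. apply Derive_ext. intros; apply H2.
  - intros s t x. apply (derive_periodic (fun x => f s t x) (2 * PI) 0).
    + intros u. eexists. apply Hd.
    + intros u. rewrite H3. ring.
Qed.

Lemma smooth_torus_cont2 T f s : smooth_torus T f -> cont2 (f s).
Proof. intros H. apply cont3_slice, smooth3_cont3, H. Qed.

Lemma cf_dt3 T f s m k al : 0 < T -> smooth_torus T f ->
  cf T (dt3 f s) m k al = omega T m * cf T (f s) m k (al - PI / 2).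
Proof.
  intros HT Hf. apply cf_dt; auto.
  - now apply smooth_torus_cont2 with T.
  - now apply smooth_torus_cont2 with T, smooth_torus_dt.
  - apply (smooth3_dt f), Hf.
  - apply Hf.
Qed.

Lemma cf_dx3 T f s m k al : smooth_torus T f ->
  cf T (dx3 f s) m k al = IZR k * cf T (f s) m k (al - PI / 2).
Proof.
  intros Hf. apply cf_dx; auto.
  - now apply smooth_torus_cont2 with T.
  - now apply smooth_torus_cont2 with T, smooth_torus_dx.
  - apply (smooth3_dx f), Hf.
  - apply Hf.
Qed.

Definition torus_deriv (l : list nat) (f : R -> R -> R -> R) : R -> R -> R -> R :=
  fold_right (fun i f => match i with O => dt3 f | _ => dx3 f end) f l.

Lemma smooth_torus_deriv T l f : smooth_torus T f -> smooth_torus T (torus_deriv l f).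
Proof.
  intros Hf. induction l as [|[|i] l IH]; [exact Hf | |]; simpl;
    [now apply smooth_torus_dt | now apply smooth_torus_dx].
Qed.

Lemma smooth_torus_decay T f s N : 0 < T -> smooth_torus T f -> exists C, 0 <= C /\
  forall m k al, Rabs (cf T (f s) m k al) <= C / weight m k ^ N.
Proof.
  intros HT Hf.
  (* The time argument of [decay_weight] is a dummy: s is fixed and smoothness alone gives the
     decay. *)
  destruct (decay_weight T (fun _ => cf T (f s)) HT) with (N := N) as (S0 & C & HC & H).
  - intros n p.
    assert (Hx : forall g, smooth_torus T g -> exists S0 C : R, forall (u : R) m k al, S0 < u ->
      Rabs (IZR k) ^ p * Rabs (cf T (g s) m k al) <= C).
    { induction p as [|p IH]; intros g Hg.
      - exists 0, (2 * PI * T + I2 T (fun t x => g s t x ^ 2)). intros _ m k al _.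
        simpl pow at 1. rewrite Rmult_1_l.
        pose proof (smooth_torus_cont2 T g s Hg) as Hc.
        apply (cf_bound_sqr T (g s) (fun t x => g s t x ^ 2));
          [exact HT | exact Hc | | intros; apply Rle_refl].
        simpl. auto using cont2_mult, cont2_const.
      - destruct (IH _ (smooth_torus_dx T g Hg)) as (S0 & C & H). exists S0, C.
        intros u m k al Hu. specialize (H u m k (al + PI / 2) Hu).
        rewrite cf_dx3 in H by easy. replace (al + PI / 2 - PI / 2) with al in H by ring.
        rewrite Rabs_mult in H. simpl. lra. }
    enough (Ht : forall g, smooth_torus T g -> exists S0 C : R, forall (u : R) m k al, S0 < u ->
      Rabs (omega T m) ^ n * (Rabs (IZR k) ^ p * Rabs (cf T (g s) m k al)) <= C)
      by now apply Ht.
    induction n as [|n IH]; intros g Hg.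
    + destruct (Hx g Hg) as (S0 & C & H). exists S0, C. intros. simpl. rewrite Rmult_1_l. eauto.
    + destruct (IH _ (smooth_torus_dt T g Hg)) as (S0 & C & H). exists S0, C.
      intros u m k al Hu. specialize (H u m k (al + PI / 2) Hu).
      rewrite cf_dt3 in H by easy. replace (al + PI / 2 - PI / 2) with al in H by ring.
      rewrite Rabs_mult in H. simpl. lra.
  - exists C. split; [exact HC|]. intros m k al. apply (H (S0 + 1)). lra.
Qed.

(** A derivative multiplies by a frequency, at most (1 + 2 PI / T) weight, and shifts the phase;
    hence the bound is required for all phases at once. *)
Lemma cf_torus_deriv_diff T l f s s' m k b : 0 < T -> smooth_torus T f ->
  (forall al, Rabs (cf T (f s) m k al - cf T (f s') m k al) <= b) ->
  forall al, Rabs (cf T (torus_deriv l f s) m k al - cf T (torus_deriv l f s') m k al)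
    <= ((1 + 2 * PI / T) * weight m k) ^ length l * b.
Proof.
  intros HT Hf Hb. pose proof PI_RGT_0 as HP.
  set (w := 2 * PI / T). assert (Hw : 0 < w) by (apply Rdiv_lt_0_compat; lra).
  assert (Hb0 : 0 <= b) by (apply Rle_trans with (1 := Rabs_pos _) (2 := Hb 0)).
  pose proof (weight_ge_1 m k) as HW. pose proof (weight_ge_l m k) as HWl. pose proof (weight_ge_r m k) as HWr.
  pose proof (Rabs_le_sqr (IZR m)) as Hm. pose proof (Rabs_le_sqr (IZR k)) as Hk.
  induction l as [|i l IH]; intros al.
  - simpl. rewrite Rmult_1_l. apply Hb.
  - change (length (i :: l)) with (S (length l)). rewrite <- tech_pow_Rmult, Rmult_assoc.
    destruct i as [|i].
    + change (torus_deriv (0%nat :: l) f) with (dt3 (torus_deriv l f)).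
      rewrite !cf_dt3 by auto using smooth_torus_deriv.
      rewrite <- Rmult_minus_distr_l, Rabs_mult.
      apply Rmult_le_compat; auto using Rabs_pos.
      unfold omega. fold w. rewrite Rabs_mult, (Rabs_pos_eq w) by lra.
      assert (w * Rabs (IZR m) <= w * weight m k) by (apply Rmult_le_compat_l; lra). lra.
    + change (torus_deriv (S i :: l) f) with (dx3 (torus_deriv l f)).
      rewrite !(cf_dx3 T) by auto using smooth_torus_deriv.
      rewrite <- Rmult_minus_distr_l, Rabs_mult.
      apply Rmult_le_compat; auto using Rabs_pos.
      assert (0 <= w * weight m k) by (apply Rmult_le_pos; lra). lra.
Qed.

Lemma uniform_cauchy T f l : 0 < T -> smooth_torus T f ->
  (forall N eps, 0 < eps -> exists S0, forall s s' m k al, S0 < s -> S0 < s' ->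
    Rabs (cf T (f s) m k al - cf T (f s') m k al) <= eps / weight m k ^ N) ->
  forall eps, 0 < eps -> exists S0, forall s s' t x, S0 < s -> S0 < s' ->
    Rabs (torus_deriv l f s t x - torus_deriv l f s' t x) < eps.
Proof.
  intros HT Hf HC eps He. pose proof PI_RGT_0 as HP.
  set (w := 2 * PI / T). assert (Hw : 0 < w) by (apply Rdiv_lt_0_compat; lra).
  assert (Hwl : 0 < (1 + w) ^ length l) by (apply pow_lt; lra).
  (* Makes the sup bound 25 B / (2 PI T) equal to eps / 2. *)
  set (B := eps * (2 * PI * T) / 50).
  assert (HB : 0 < B).
  { unfold B. assert (0 < eps * (2 * PI * T)) by
      (apply Rmult_lt_0_compat; [lra | apply Rmult_lt_0_compat; lra]). lra. }
  (* One power of [weight] per derivative, and one more to sum the series. *)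
  destruct (HC (S (length l)) (B / (1 + w) ^ length l)) as [S0 H];
    [now apply Rdiv_lt_0_compat|].
  exists S0. intros s s' t x Hs Hs'.
  apply Rle_lt_trans with (25 * B / (2 * PI * T)).
  - destruct (smooth_torus_deriv T l f Hf) as (H1 & H2 & H3).
    assert (Hc : forall s, cont2 (torus_deriv l f s)) by (intros; now apply cont3_slice, smooth3_cont3).
    apply (fourier_sup2 T (fun t x => torus_deriv l f s t x - torus_deriv l f s' t x)); auto with cont.
    + intros; now rewrite !H2.
    + intros; now rewrite !H3.
    + intros m k al. rewrite cf_minus by auto.
      eapply Rle_trans.
      * apply (cf_torus_deriv_diff T l f s s' m k (B / (1 + w) ^ length l / weight m k ^ (S (length l)))); auto.
      * right. fold w. rewrite Rpow_mult_distr. simpl. pose proof (weight_ge_1 m k).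
        field. repeat (apply conj); first [apply pow_nonzero; lra | lra].
  - unfold B. field_simplify; [|lra]. lra.
Qed.

(** * Uniform limits of all torus derivatives *)

Definition torus_limit (f : R -> R -> R -> R) (l : list nat) (t x : R) : R :=
  real (Lim (fun s => torus_deriv l f s t x) p_infty).

Lemma torus_limit_uniform f l :
  (forall eps, 0 < eps -> exists S0, forall s s' t x, S0 < s -> S0 < s' ->
    Rabs (torus_deriv l f s t x - torus_deriv l f s' t x) < eps) ->
  forall eps, 0 < eps -> exists S0, forall s t x, S0 < s ->
    Rabs (torus_deriv l f s t x - torus_limit f l t x) < eps.
Proof.
  intros H eps He.
  assert (Hlim : forall t x, is_lim (fun s => torus_deriv l f s t x) p_infty (torus_limit f l t x)).
  { intros t x.
    assert (Hex : exists y : R, filterlim (fun s => torus_deriv l f s t x) (Rbar_locally p_infty) (locally y)).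
    { apply (filterlim_locally_cauchy (U := R_CompleteSpace)). intros e.
      destruct (H e (cond_pos e)) as [S0 HS]. exists (fun s => S0 < s). split.
      - exists S0. auto.
      - intros u v Hu Hv. apply (HS v u t x Hv Hu). }
    destruct Hex as [y Hy]. unfold torus_limit.
    rewrite (is_lim_unique (fun s => torus_deriv l f s t x) p_infty y Hy). exact Hy. }
  destruct (H (eps / 2)) as [S0 HS]; [lra|]. exists S0. intros s t x Hs.
  destruct (Hlim t x (fun y => Rabs (y - torus_limit f l t x) < eps / 2)) as [S1 H1].
  { assert (He2 : 0 < eps / 2) by lra. exists (mkposreal _ He2). intros y Hy. exact Hy. }
  set (s' := Rmax S0 S1 + 1).
  assert (Hs' : S0 < s' /\ S1 < s').
  { unfold s'. pose proof (Rmax_l S0 S1). pose proof (Rmax_r S0 S1). lra. }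
  specialize (H1 s' (proj2 Hs')). specialize (HS s s' t x Hs (proj1 Hs')).
  replace (torus_deriv l f s t x - torus_limit f l t x) with
    ((torus_deriv l f s t x - torus_deriv l f s' t x) + (torus_deriv l f s' t x - torus_limit f l t x)) by ring.
  eapply Rle_lt_trans; [apply Rabs_triang|]. lra.
Qed.

Lemma uniform_limit_cont2 (g : R -> R -> R -> R) (h : R -> R -> R) :
  (forall s, cont2 (g s)) ->
  (forall eps, 0 < eps -> exists S0, forall s t x, S0 < s -> Rabs (g s t x - h t x) < eps) ->
  cont2 h.
Proof.
  intros Hg Hu t x eps He. destruct (Hu (eps / 3)) as [S0 HS]; [lra|].
  destruct (Hg (S0 + 1) t x (eps / 3)) as (d & Hd & H); [lra|].
  exists d. split; [exact Hd|]. intros t' x' H1 H2. specialize (H t' x' H1 H2).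
  pose proof (HS (S0 + 1) t x ltac:(lra)) as A1. pose proof (HS (S0 + 1) t' x' ltac:(lra)) as A2.
  apply Rabs_lt_between in H. apply Rabs_lt_between in A1. apply Rabs_lt_between in A2.
  apply Rabs_lt_between. lra.
Qed.

Lemma uniform_limit_derive (g g' : R -> R -> R) (h h' : R -> R) x :
  (forall s y, is_derive (g s) y (g' s y)) ->
  (forall eps, 0 < eps -> exists S0, forall s y, S0 < s -> Rabs (g s y - h y) < eps) ->
  (forall eps, 0 < eps -> exists S0, forall s y, S0 < s -> Rabs (g' s y - h' y) < eps) ->
  (forall y, continuous h' y) ->
  is_derive h x (h' x).
Proof.
  intros Hd Hg Hg' Hc. apply is_derive_Reals.
  assert (Hn : forall S0, exists N, forall n, (N <= n)%nat -> S0 < INR n).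
  { intros S0. destruct (INR_unbounded S0) as [N HN]. exists N. intros n Hn.
    apply Rlt_le_trans with (1 := HN). now apply le_INR. }
  (* The theorem on derivatives of uniform limits concerns sequences, so s runs through the natural
     numbers on a ball around x. *)
  assert (Hb : Boule x (mkposreal 1 Rlt_0_1) x) by (unfold Boule; rewrite Rminus_diag, Rabs_R0; exact Rlt_0_1).
  apply (derivable_pt_lim_CVU (fun n => g (INR n)) (fun n => g' (INR n)) h h' x x
    (mkposreal 1 Rlt_0_1) Hb).
  - intros y n _. apply is_derive_Reals, Hd.
  - intros y _ eps He. destruct (Hg eps He) as [S0 HS]. destruct (Hn S0) as [N HN].
    exists N. intros n Hn'. apply HS, HN. exact Hn'.
  - intros eps He. destruct (Hg' eps He) as [S0 HS]. destruct (Hn S0) as [N HN].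
    exists N. intros n y Hn' _. rewrite <- Rabs_Ropp, Ropp_minus_distr. apply HS, HN. exact Hn'.
  - intros y _. apply continuity_pt_filterlim, Hc.
Qed.

Lemma smooth_torus_converges T f : smooth_torus T f ->
  (forall l eps, 0 < eps -> exists S0, forall s s' t x, S0 < s -> S0 < s' ->
    Rabs (torus_deriv l f s t x - torus_deriv l f s' t x) < eps) ->
  smooth2 (torus_limit f nil) /\
  forall l eps, 0 < eps -> exists S0, forall s, S0 < s -> forall t x,
    Rabs (Dlist l (fun v => f s (v 0%nat) (v 1%nat) - torus_limit f nil (v 0%nat) (v 1%nat)) (pt2 t x)) < eps.
Proof.
  intros Hf HC.
  assert (Hu := fun l => torus_limit_uniform f l (HC l)).
  assert (Hcont : forall l, cont2 (torus_limit f l)).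
  { intros l. apply (uniform_limit_cont2 (torus_deriv l f)); [|apply Hu].
    intros s. now apply smooth_torus_cont2 with T, smooth_torus_deriv. }
  (* The limit of each derivative was defined separately; only here is it identified as the
     derivative of the preceding limit. *)
  assert (Hdt : forall l t x, is_derive (fun t => torus_limit f l t x) t (torus_limit f (0%nat :: l) t x)).
  { intros l t x.
    apply (uniform_limit_derive (fun s t => torus_deriv l f s t x) (fun s t => torus_deriv (0%nat :: l) f s t x)
      (fun t => torus_limit f l t x) (fun t => torus_limit f (0%nat :: l) t x)).
    - intros s y. apply (smooth3_dt (torus_deriv l f)), (smooth_torus_deriv T), Hf.
    - intros eps He. destruct (Hu l eps He) as [S0 HS]. exists S0. auto.
    - intros eps He. destruct (Hu (0%nat :: l) eps He) as [S0 HS]. exists S0. auto.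
    - apply cont2_2, Hcont. }
  assert (Hdx : forall i l t x, is_derive (fun x => torus_limit f l t x) x (torus_limit f (S i :: l) t x)).
  { intros i l t x.
    apply (uniform_limit_derive (fun s => torus_deriv l f s t) (fun s => torus_deriv (S i :: l) f s t)
      (fun x => torus_limit f l t x) (fun x => torus_limit f (S i :: l) t x)).
    - intros s y. apply (smooth3_dx (torus_deriv l f)), (smooth_torus_deriv T), Hf.
    - intros eps He. destruct (Hu l eps He) as [S0 HS]. exists S0. auto.
    - intros eps He. destruct (Hu (S i :: l) eps He) as [S0 HS]. exists S0. auto.
    - apply cont2_1, Hcont. }
  split.
  - exists (fun g => exists l, g = fun v => torus_limit f l (v 0%nat) (v 1%nat)).
    split; [now exists nil|]. intros g [l ->]. split.
    + intros v eps He. destruct (Hcont l (v 0%nat) (v 1%nat) eps He) as (d & Hd & H).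
      exists d. split; [exact Hd|]. intros y Hy. apply H; apply Hy; lia.
    + intros [|[|i]] Hi; [| |lia].
      * split; [intros v; exists (torus_limit f (0%nat :: l) (v 0%nat) (v 1%nat)); exact (Hdt l _ _)|].
        exists (0%nat :: l). apply functional_extensionality. intros v.
        exact (is_derive_unique _ _ _ (Hdt l (v 0%nat) (v 1%nat))).
      * split; [intros v; exists (torus_limit f (1%nat :: l) (v 0%nat) (v 1%nat)); exact (Hdx O l _ _)|].
        exists (1%nat :: l). apply functional_extensionality. intros v.
        exact (is_derive_unique _ _ _ (Hdx O l (v 0%nat) (v 1%nat))).
  - intros l eps He.
    (* [Dlist] admits any index. An index of 2 or more differentiates in a coordinate on which the
       function does not depend and gives 0, and all later derivatives remain 0. *)
    assert (HD : forall s,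
      Dlist l (fun v => f s (v 0%nat) (v 1%nat) - torus_limit f nil (v 0%nat) (v 1%nat)) =
      if forallb (fun i => Nat.ltb i 2) l
      then fun v => torus_deriv l f s (v 0%nat) (v 1%nat) - torus_limit f l (v 0%nat) (v 1%nat)
      else fun _ => 0).
    { intros s. induction l as [|i l IH]; [reflexivity|].
      change (Dlist (i :: l)) with (fun g => pd i (Dlist l g)). cbv beta. rewrite IH.
      simpl forallb. destruct (forallb (fun i => Nat.ltb i 2) l).
      - destruct i as [|[|i]]; simpl; apply functional_extensionality; intros v.
        + apply is_derive_unique.
          apply (is_derive_minus (fun t => torus_deriv l f s t (v 1%nat)) (fun t => torus_limit f l t (v 1%nat)));
            [|apply Hdt].
          apply (smooth3_dt (torus_deriv l f)), (smooth_torus_deriv T), Hf.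
        + apply is_derive_unique.
          apply (is_derive_minus (fun x => torus_deriv l f s (v 0%nat) x) (fun x => torus_limit f l (v 0%nat) x));
            [|apply (Hdx O)].
          apply (smooth3_dx (torus_deriv l f)), (smooth_torus_deriv T), Hf.
        + apply (Derive_const (torus_deriv l f s (v 0%nat) (v 1%nat) - torus_limit f l (v 0%nat) (v 1%nat))).
      - rewrite Bool.andb_false_r. apply functional_extensionality. intros v.
        apply (Derive_const 0). }
    destruct (Hu l eps He) as [S0 HS]. exists S0. intros s Hs t x. rewrite HD.
    destruct (forallb (fun i => Nat.ltb i 2) l).
    + apply (HS s t x Hs).
    + rewrite Rabs_R0. exact He.
Qed.

(** * Growth of the coefficients from finite energy, and the transformed equations *)

Lemma energy_bounded (e : R -> R) : (forall s, 0 <= e s) ->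
  ex_RInt_gen e (Rbar_locally m_infty) (Rbar_locally p_infty) ->
  exists E, forall s, 0 <= s -> ex_RInt e 0 s /\ RInt e 0 s <= E.
Proof.
  intros He [l Hl]. exists (l + 1).
  destruct (Hl (fun y => y < l + 1)) as [P Q [M1 HP] [M2 HQ] HPQ].
  { exists (mkposreal 1 Rlt_0_1). intros y Hy. apply Rabs_lt_between in Hy.
    unfold minus, plus, opp in Hy; simpl in Hy. lra. }
  intros s Hs.
  (* An interval containing [0, s] and large enough that its integral is below l + 1; since e >= 0,
     the part over [0, s] is no larger. *)
  set (a := Rmin M1 0 - 1). set (b := Rmax M2 s + 1).
  assert (Ha : a < M1 /\ a < 0) by (unfold a; pose proof (Rmin_l M1 0); pose proof (Rmin_r M1 0); lra).
  assert (Hb : M2 < b /\ s < b) by (unfold b; pose proof (Rmax_l M2 s); pose proof (Rmax_r M2 s); lra).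
  destruct (HPQ a b (HP a (proj1 Ha)) (HQ b (proj1 Hb))) as (y & Hy & Hy1). simpl in Hy.
  assert (Hab : ex_RInt e a b) by (now exists y).
  assert (Hb0 : ex_RInt e 0 b) by (apply (ex_RInt_Chasles_2 (V := R_CompleteNormedModule)) with a; [lra | exact Hab]).
  assert (H0s : ex_RInt e 0 s) by (apply (ex_RInt_Chasles_1 (V := R_CompleteNormedModule)) with b; [lra | exact Hb0]).
  assert (Hsb : ex_RInt e s b) by (apply (ex_RInt_Chasles_2 (V := R_CompleteNormedModule)) with 0; [lra | exact Hb0]).
  assert (Ha0 : ex_RInt e a 0) by (apply (ex_RInt_Chasles_1 (V := R_CompleteNormedModule)) with b; [lra | exact Hab]).
  split; [exact H0s|].
  assert (E1 : RInt e a 0 + RInt e 0 b = RInt e a b)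
    by apply (RInt_Chasles (V := R_CompleteNormedModule) e a 0 b Ha0 Hb0).
  assert (E2 : RInt e 0 s + RInt e s b = RInt e 0 b)
    by apply (RInt_Chasles (V := R_CompleteNormedModule) e 0 s b H0s Hsb).
  rewrite (is_RInt_unique _ _ _ _ Hy) in E1.
  assert (G1 : 0 <= RInt e a 0) by (apply RInt_ge_0; auto; lra).
  assert (G2 : 0 <= RInt e s b) by (apply RInt_ge_0; auto; lra).
  lra.
Qed.

(** The s-derivative of the coefficient is at most 2 PI T + e s, and integrating from 0 gives 2 PI T
    s + E. *)
Lemma cf_growth T f (e : R -> R) E m k al : 0 < T -> smooth_torus T f ->
  (forall s, I2 T (fun t x => ds3 f s t x ^ 2) <= e s) ->
  (forall s, 0 <= s -> ex_RInt e 0 s /\ RInt e 0 s <= E) ->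
  exists K, 0 <= K /\ forall s, 0 <= s -> Rabs (cf T (f s) m k al) <= K + K * s.
Proof.
  intros HT Hf He HE. pose proof two_PI_pos as HP.
  destruct (smooth3_ds f (proj1 Hf)) as [Hd Hds].
  destruct (smooth3_ds _ Hds) as [Hd2 Hds2].
  assert (E0 : 0 <= E).
  { destruct (HE 0 (Rle_refl 0)) as [_ H]. rewrite RInt_point in H. exact H. }
  set (C := 2 * PI * T). assert (HC : 0 < C) by (unfold C; apply Rmult_lt_0_compat; lra).
  exists (Rabs (cf T (f 0) m k al) + C + E).
  assert (HK : 0 <= Rabs (cf T (f 0) m k al)) by apply Rabs_pos.
  split; [lra|]. intros s Hs.
  set (g' := fun s => cf T (ds3 f s) m k al).
  assert (Hc : forall s, continuous g' s).
  { intros u. apply (is_derive_continuous g' u (cf T (ds3 (ds3 f) u) m k al)).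
    apply (cf_ds T (ds3 f) (ds3 (ds3 f)) m k al u HT);
      [now apply smooth3_cont3 | now apply smooth3_cont3 | exact Hd2]. }
  assert (Hi : cf T (f s) m k al - cf T (f 0) m k al = RInt g' 0 s).
  { symmetry. apply (RInt_primitive (fun s => cf T (f s) m k al)); [|exact Hc].
    intros u. apply (cf_ds T f (ds3 f) m k al u HT);
      [apply smooth3_cont3, Hf | now apply smooth3_cont3 | exact Hd]. }
  destruct (HE s Hs) as [Hex Hle].
  assert (Hb : Rabs (RInt g' 0 s) <= C * s + E).
  { eapply Rle_trans; [apply abs_RInt_le; [exact Hs | now apply ex_RInt_cont]|].
    apply Rle_trans with (RInt (fun s => C + e s) 0 s).
    - apply RInt_le; [exact Hs | | |].
      + apply ex_RInt_cont. intros u. apply (continuous_comp g' Rabs); [apply Hc | apply continuous_Rabs].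
      + apply (ex_RInt_plus (V := R_NormedModule)); [apply ex_RInt_const | exact Hex].
      + intros u _.
        assert (Hcu : cont2 (ds3 f u)) by now apply cont3_slice, smooth3_cont3.
        assert (Hcu2 : cont2 (fun t x => ds3 f u t x ^ 2))
          by (simpl; auto using cont2_mult, cont2_const).
        pose proof (cf_bound_sqr T (ds3 f u) (fun t x => ds3 f u t x ^ 2) m k al HT Hcu Hcu2
          (fun t x => Rle_refl _)) as Hgu.
        specialize (He u). unfold g', C. lra.
    - rewrite RInt_plusR, RInt_constR; [lra | apply ex_RInt_const | exact Hex]. }
  replace (cf T (f s) m k al) with
    (cf T (f 0) m k al + (cf T (f s) m k al - cf T (f 0) m k al)) by ring.
  rewrite Hi. eapply Rle_trans; [apply Rabs_triang|].
  assert (0 <= (Rabs (cf T (f 0) m k al) + E) * s) by (apply Rmult_le_pos; lra). nra.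
Qed.

Lemma gradS_eq rho t x q p Z i : (i < 4)%nat ->
  gradS rho t x q p Z i =
  match i with
  | O => Z 0%nat + rho_per rho (q - x)
  | 1%nat => Z 1%nat
  | 2%nat => - Z 2%nat
  | _ => - Z 3%nat
  end.
Proof.
  intros Hi. unfold gradS, Sfun. generalize (rho_per rho (q - x)). intros r.
  destruct i as [|[|[|[|i]]]]; [| | | |lia]; unfold upd; simpl;
    apply is_derive_unique; auto_derive; try easy; field.
Qed.

Lemma field_equations T (rho : R -> R) (uq up : R -> R -> R) (Zt : R -> R -> R -> nat -> R) :
  0 < T -> smooth1 rho -> bump rho -> smooth2 uq ->
  (forall i, (i < 4)%nat -> smooth_torus T (fun s t x => Zt s t x i)) ->
  (forall s t x i, (i < 4)%nat ->
     Derive (fun s' => Zt s' t x i) s =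
     - matvec 4 M1 (fun j => Derive (fun t' => Zt s t' x j) t) i
     - matvec 4 M2 (fun j => Derive (fun x' => Zt s t x' j) x) i
     + gradS rho t x (uq s t) (up s t) (Zt s t x) i) ->
  mode_system T (fun i s => cf T (fun t x => Zt s t x i))
    (fun s => cf T (fun t x => rper rho 0 (uq s t - x))).
Proof.
  intros HT Hrs Hrb Huq HZ Heq s m k al.
  set (f := fun i s t x => Zt s t x i).
  assert (Hf : forall i, (i < 4)%nat -> smooth_torus T (f i)) by exact HZ.
  assert (Hc : forall i, (i < 4)%nat -> cont2 (f i s))
    by (intros; apply smooth_torus_cont2 with T; auto).
  assert (Hct : forall i, (i < 4)%nat -> cont2 (dt3 (f i) s))
    by (intros; apply smooth_torus_cont2 with T, smooth_torus_dt; auto).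
  assert (Hcx : forall i, (i < 4)%nat -> cont2 (dx3 (f i) s))
    by (intros; apply smooth_torus_cont2 with T, smooth_torus_dx; auto).
  assert (HcF : cont2 (fun t x => rper rho 0 (uq s t - x))).
  { apply cont2_rper_sub; auto. intros t. eapply is_derive_continuous.
    apply (smooth2_derive uq Huq). }
  assert (Hs : forall i, (i < 4)%nat ->
    is_derive (fun s => cf T (f i s) m k al) s (cf T (ds3 (f i) s) m k al)).
  { intros i Hi. destruct (smooth3_ds (f i)) as [H1 H2]; [apply Hf, Hi|].
    apply (cf_ds T (f i) (ds3 (f i)) m k al s HT);
      [apply smooth3_cont3, Hf, Hi | now apply smooth3_cont3 | exact H1]. }
  assert (D0 : forall t x, ds3 (f 0%nat) s t x = dt3 (f 1%nat) s t x + - dx3 (f 2%nat) s t x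
     + f 0%nat s t x + rper rho 0 (uq s t - x)).
  { intros t x. unfold ds3, f. rewrite Heq, gradS_eq by lia. unfold matvec. simpl.
    unfold rper. simpl. change (rho_per (fun x => rho x)) with (rho_per rho).
    change (Derive_n rho 0) with rho. unfold dt3, dx3. ring. }
  assert (D1 : forall t x, ds3 (f 1%nat) s t x = - dt3 (f 0%nat) s t x + dx3 (f 3%nat) s t x
     + f 1%nat s t x).
  { intros t x. unfold ds3, f. rewrite Heq, gradS_eq by lia. unfold matvec, dt3, dx3. simpl. ring. }
  assert (D2 : forall t x, ds3 (f 2%nat) s t x = - dt3 (f 3%nat) s t x + dx3 (f 0%nat) s t x
     + - f 2%nat s t x).
  { intros t x. unfold ds3, f. rewrite Heq, gradS_eq by lia. unfold matvec, dt3, dx3. simpl. ring. }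
  assert (D3 : forall t x, ds3 (f 3%nat) s t x = dt3 (f 2%nat) s t x + - dx3 (f 1%nat) s t x
     + - f 3%nat s t x).
  { intros t x. unfold ds3, f. rewrite Heq, gradS_eq by lia. unfold matvec, dt3, dx3. simpl. ring. }
  assert (L0 : (0 < 4)%nat) by lia. assert (L1 : (1 < 4)%nat) by lia.
  assert (L2 : (2 < 4)%nat) by lia. assert (L3 : (3 < 4)%nat) by lia.
  split; [|split; [|split]].
  - evar_last; [apply (Hs 0%nat L0)|].
    rewrite (cf_ext _ _ _ _ _ _ D0), !cf_plus, cf_opp, cf_dt3, (cf_dx3 T) by auto 6 with cont.
    unfold f. ring.
  - evar_last; [apply (Hs 1%nat L1)|].
    rewrite (cf_ext _ _ _ _ _ _ D1), !cf_plus, cf_opp, cf_dt3, (cf_dx3 T) by auto 6 with cont.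
    unfold f. ring.
  - evar_last; [apply (Hs 2%nat L2)|].
    rewrite (cf_ext _ _ _ _ _ _ D2), !cf_plus, !cf_opp, cf_dt3, (cf_dx3 T) by auto 6 with cont.
    unfold f. ring.
  - evar_last; [apply (Hs 3%nat L3)|].
    rewrite (cf_ext _ _ _ _ _ _ D3), !cf_plus, !cf_opp, cf_dt3, (cf_dx3 T) by auto 6 with cont.
    unfold f. ring.
Qed.

Theorem theorem5p1
  (T : R) (HT : 0 < T)
  (V : R -> R -> R) (rho : R -> R)
  (* q-coordinate of u~ (a lift to R of the S^1-valued coordinate), p-coordinate,
     and Z~ = (Z~ 0, Z~ 1, Z~ 2, Z~ 3) = (phi~, pi1~, pi2~, o~) *)
  (uq up : R -> R -> R) (Zt : R -> R -> R -> nat -> R)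
  (* potentials V_t(q): smooth, T-periodic in t, functions on S^1, uniformly bounded *)
  (HVs : smooth2 V)
  (HVT : forall t q, V (t + T) q = V t q)
  (HVq : forall t q, V t (q + 2 * PI) = V t q)
  (HVb : exists C, forall t q, Rabs (V t q) <= C)
  (* rho smooth with support in (-r, r), r < pi *)
  (Hrho_s : smooth1 rho)
  (Hrho_supp : exists r, r < PI /\ forall y, rho y <> 0 -> - r < y < r)
  (* regularity and periodicity of F~ = (u~, Z~) *)
  (Huq_s : smooth2 uq) (Hup_s : smooth2 up)
  (Huq_T : exists k : Z, forall s t, uq s (t + T) = uq s t + 2 * PI * IZR k)
  (Hup_T : forall s t, up s (t + T) = up s t)
  (HZ_s : forall i, (i < 4)%nat -> smooth3 (fun s t x => Zt s t x i))
  (HZ_T : forall s t x i, Zt s (t + T) x i = Zt s t x i)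
  (HZ_x : forall s t x i, Zt s t (x + 2 * PI) i = Zt s t x i)
  (* Floer-type equation for u~ *)
  (Hequ : forall s t i, (i < 2)%nat ->
     vec2 (Derive (fun s' => uq s' t) s) (Derive (fun s' => up s' t) s) i =
     - matvec 2 Jmat (vec2 (Derive (fun t' => uq s t') t)
                           (Derive (fun t' => up s t') t)) i
     + gradH V rho t (uq s t) (up s t) (fun x => Zt s t x 0%nat) i)
  (* equation for Z~ *)
  (HeqZ : forall s t x i, (i < 4)%nat ->
     Derive (fun s' => Zt s' t x i) s =
     - matvec 4 M1 (fun j => Derive (fun t' => Zt s t' x j) t) i
     - matvec 4 M2 (fun j => Derive (fun x' => Zt s t x' j) x) i
     + gradS rho t x (uq s t) (up s t) (Zt s t x) i)
  (* finite energy *)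
  (Henergy : ex_RInt_gen
     (fun s =>
        RInt (fun t => (Derive (fun s' => uq s' t) s) ^ 2
                       + (Derive (fun s' => up s' t) s) ^ 2) 0 T
      + RInt (fun t => RInt (fun x =>
                 sumR 4 (fun i => (Derive (fun s' => Zt s' t x i) s) ^ 2))
                 0 (2 * PI)) 0 T)
     (Rbar_locally m_infty) (Rbar_locally p_infty))
  (* convergence of u~_s to a smooth u+ and of d_s u~_s to 0, in C^infinity *)
  (Huplus : exists uqp upp : R -> R,
     smooth1 uqp /\ smooth1 upp /\
     (exists k : Z, forall t, uqp (t + T) = uqp t + 2 * PI * IZR k) /\
     (forall t, upp (t + T) = upp t) /\
     (forall (n : nat) eps, 0 < eps -> exists S0, forall s, S0 < s -> forall t,
        Rabs (Derive_n (fun t' => uq s t' - uqp t') n t) < eps /\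
        Rabs (Derive_n (fun t' => up s t' - upp t') n t) < eps /\
        Rabs (Derive_n (fun t' => Derive (fun s' => uq s' t') s) n t) < eps /\
        Rabs (Derive_n (fun t' => Derive (fun s' => up s' t') s) n t) < eps))
  (* Diophantine hypothesis *)
  (Hirr : irrationality_measure_eq ((T / (2 * PI)) ^ 2) 2) :
  exists Zp : R -> R -> nat -> R,
    (forall i, (i < 4)%nat -> smooth2 (fun t x => Zp t x i)) /\
    (forall t x i, Zp (t + T) x i = Zp t x i) /\
    (forall t x i, Zp t (x + 2 * PI) i = Zp t x i) /\
    (forall i, (i < 4)%nat -> forall (l : list nat) eps, 0 < eps ->
       exists S0, forall s, S0 < s -> forall t x,
         Rabs (Dlist l (fun v => Zt s (v 0%nat) (v 1%nat) i - Zp (v 0%nat) (v 1%nat) i)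
                 (pt2 t x)) < eps).
Proof.
  destruct Huplus as (uqp & upp & Huqp & _ & [kp HuqpT] & _ & Hconv).
  destruct Huq_T as [kq HuqT].
  assert (Hzt : forall i, (i < 4)%nat -> smooth_torus T (fun s t x => Zt s t x i)).
  { intros i Hi. split; [now apply HZ_s | split; intros; [apply HZ_T | apply HZ_x]]. }
  assert (Hconv_q : forall (n : nat) eps, 0 < eps -> exists S0, forall s, S0 < s -> forall t,
     Rabs (Derive_n (fun t' => uq s t' - uqp t') n t) < eps).
  { intros n eps He. destruct (Hconv n eps He) as [S0 HS]. exists S0. intros s Hs t.
    apply (HS s Hs t). }
  assert (Htame : forall n j, tame T n (fun s t x => rper rho j (uq s t - x))).
  { apply (tame_forcing T rho uq kq); auto.
    apply (tame_derive_n T uq uqp (2 * PI * IZR kp) (2 * PI * IZR kq)); auto. }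
  destruct (small_divisor T HT Hirr) as (kap & Hkap & Hdiv).
  set (e := fun s =>
        RInt (fun t => (Derive (fun s' => uq s' t) s) ^ 2
                       + (Derive (fun s' => up s' t) s) ^ 2) 0 T
      + RInt (fun t => RInt (fun x =>
                 sumR 4 (fun i => (Derive (fun s' => Zt s' t x i) s) ^ 2))
                 0 (2 * PI)) 0 T).
  assert (Hds : forall i s, (i < 4)%nat -> cont2 (fun t x => ds3 (fun s t x => Zt s t x i) s t x ^ 2)).
  { intros i s Hi. simpl. assert (Hc : cont2 (ds3 (fun s t x => Zt s t x i) s))
      by now apply cont3_slice, smooth3_cont3, smooth3_ds, Hzt.
    auto using cont2_mult, cont2_const. }
  assert (Hsum : forall s, cont2 (fun t x =>
     sumR 4 (fun i => ds3 (fun s t x => Zt s t x i) s t x ^ 2))).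
  { intros s. repeat apply cont2_plus; try (apply Hds; lia). apply cont2_const. }
  (* Nonnegativity of the u-part lets the total energy density dominate the squared s-derivative of
     each component of Z. *)
  assert (He_u : forall s, 0 <= RInt (fun t => (Derive (fun s' => uq s' t) s) ^ 2
                       + (Derive (fun s' => up s' t) s) ^ 2) 0 T).
  { intros s. apply RInt_ge_0; [lra | | intros; nra].
    apply ex_RInt_cont. intros t.
    assert (Hc : forall f, smooth2 f -> continuous (fun t => Derive (fun s' => f s' t) s ^ 2) t).
    { intros f Hf. pose proof (cont2_1 _ s (smooth2_cont2 _ (smooth2_derive1 f Hf)) t) as Hc.
      simpl. apply continuous_multR; [exact Hc|]. apply continuous_multR; [exact Hc|].
      apply continuous_const. }
    apply (continuous_plus (fun t => Derive (fun s' => uq s' t) s ^ 2)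
      (fun t => Derive (fun s' => up s' t) s ^ 2)); auto. }
  assert (He_z : forall i s, (i < 4)%nat ->
     I2 T (fun t x => ds3 (fun s t x => Zt s t x i) s t x ^ 2) <= e s).
  { intros i s Hi. apply Rle_trans with
      (I2 T (fun t x => sumR 4 (fun i => ds3 (fun s t x => Zt s t x i) s t x ^ 2))).
    - apply I2_le; auto. intros t x.
      assert (Hp : forall j, 0 <= ds3 (fun s t x => Zt s t x j) s t x ^ 2)
        by (intros; apply pow2_ge_0).
      pose proof (Hp 0%nat). pose proof (Hp 1%nat). pose proof (Hp 2%nat). pose proof (Hp 3%nat).
      unfold sumR. destruct i as [|[|[|[|i]]]]; [lra | lra | lra | lra | lia].
    - specialize (He_u s). unfold e.
      change (RInt (fun t => RInt (fun x =>
                 sumR 4 (fun i => (Derive (fun s' => Zt s' t x i) s) ^ 2)) 0 (2 * PI)) 0 T)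
        with (I2 T (fun t x => sumR 4 (fun i => ds3 (fun s t x => Zt s t x i) s t x ^ 2))). lra. }
  assert (He0 : forall s, 0 <= e s).
  { intros s. apply Rle_trans with (2 := He_z 0%nat s ltac:(lia)).
    replace 0 with (I2 T (fun _ _ => 0)) by (rewrite I2_const; ring).
    apply I2_le; [exact HT | apply cont2_const | apply Hds; lia | intros; apply pow2_ge_0]. }
  destruct (energy_bounded e He0 Henergy) as [E HE].
  assert (HC : forall N eps, 0 < eps -> exists S0, forall i s s' m k al, (i < 4)%nat ->
    S0 < s -> S0 < s' ->
    Rabs (cf T (fun t x => Zt s t x i) m k al - cf T (fun t x => Zt s' t x i) m k al)
      <= eps / weight m k ^ N).
  { apply (coefficients_cauchy T (fun i s => cf T (fun t x => Zt s t x i))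
      (fun s => cf T (fun t x => rper rho 0 (uq s t - x))) kap Hkap Hdiv).
    - now apply field_equations with up.
    - intros i s m k al Hi. apply cf_opp_phase.
      apply (smooth_torus_cont2 T (fun s t x => Zt s t x i)), Hzt, Hi.
    - intros m k al.
      assert (Hg := fun i Hi => cf_growth T (fun s t x => Zt s t x i) e E m k al HT (Hzt i Hi)
        (fun s => He_z i s Hi) HE).
      destruct (Hg 0%nat) as (K0 & P0 & G0); [lia|]. destruct (Hg 1%nat) as (K1 & P1 & G1); [lia|].
      destruct (Hg 2%nat) as (K2 & P2 & G2); [lia|]. destruct (Hg 3%nat) as (K3 & P3 & G3); [lia|].
      exists (K0 + K1 + K2 + K3). split; [lra|]. intros i s Hi Hs.
      specialize (G0 s Hs). specialize (G1 s Hs). specialize (G2 s Hs). specialize (G3 s Hs).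
      destruct i as [|[|[|[|i]]]]; [nra | nra | nra | nra | lia].
    - intros s N.
      assert (Hg := fun i Hi => smooth_torus_decay T (fun s t x => Zt s t x i) s N HT (Hzt i Hi)).
      destruct (Hg 0%nat) as (K0 & P0 & G0); [lia|]. destruct (Hg 1%nat) as (K1 & P1 & G1); [lia|].
      destruct (Hg 2%nat) as (K2 & P2 & G2); [lia|]. destruct (Hg 3%nat) as (K3 & P3 & G3); [lia|].
      exists (K0 + K1 + K2 + K3). split; [lra|]. intros i m k al Hi.
      assert (HW : 0 < / weight m k ^ N)
        by (apply Rinv_0_lt_compat, pow_lt; pose proof (weight_ge_1 m k); lra).
      specialize (G0 m k al). specialize (G1 m k al). specialize (G2 m k al). specialize (G3 m k al).
      unfold Rdiv in *.
      destruct i as [|[|[|[|i]]]]; [nra | nra | nra | nra | lia].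
    - now apply forcing_decay.
    - apply (forcing_cauchy T rho uq uqp); auto. exact (Hconv_q 0%nat). }
  assert (HZl : forall i, (i < 4)%nat -> forall l eps, 0 < eps -> exists S0, forall s s' t x,
    S0 < s -> S0 < s' ->
    Rabs (torus_deriv l (fun s t x => Zt s t x i) s t x - torus_deriv l (fun s t x => Zt s t x i) s' t x) < eps).
  { intros i Hi l. apply (uniform_cauchy T); auto.
    intros N eps He. destruct (HC N eps He) as [S0 HS]. exists S0. auto. }
  exists (fun t x i => torus_limit (fun s t x => Zt s t x i) nil t x).
  split; [|split; [|split]].
  - intros i Hi. apply (smooth_torus_converges T (fun s t x => Zt s t x i)); auto.
  (* Periodicity is claimed for every index, including i >= 4 where convergence is not known; [Lim]
     is total, so pointwise equality of the arguments suffices. *)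
  - intros t x i. unfold torus_limit. f_equal. apply Lim_ext. intros s. symmetry. apply HZ_T.
  - intros t x i. unfold torus_limit. f_equal. apply Lim_ext. intros s. symmetry. apply HZ_x.
  - intros i Hi. apply (smooth_torus_converges T (fun s t x => Zt s t x i)); auto.
Qed.
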